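(* Let $d,m\in\mathbb{Z}_{\ge 0}$ with $d\ge 2$. There does not exist $k\in\mathbb{Z}_{\ge 0}$ such that, for all finite ($d$-parameter simplicial) filtrations $\mathcal{F}$ over $\mathbb{R}^d$, the size $\|\mathrm{dgm}_m(\mathcal{F})\|$ belongs to $O(N^k)$, where $N$ denotes the number of simplices in $\mathcal{F}$. That is, there are no $k\in\mathbb{Z}_{\ge 0}$ and constant $C>0$ such that $\|\mathrm{dgm}_m(\mathcal{F})\|\le C\,N^k$ for every finite filtration $\mathcal{F}$ over $\mathbb{R}^d$ with $N$ simplices.
   Context: Fix a field $\mathbb{F}$. A poset $P$ is regarded as a category (a unique morphism $p\to q$ iff $p\le q$). A $P$-module is a functor $M:P\to\mathbf{vec}_{\mathbb{F}}$ to finite-dimensional $\mathbb{F}$-vector spaces. Filtrations. $\mathbb{R}^d$ carries the product order. Let $K$ be an abstract simplicial complex and $\Delta K$ the set of its subcomplexes ordered by inclusion. A ($d$-parameter simplicial) filtration of $K$ is a monotone map $\mathcal{F}:\mathbb{R}^d\to\Delta K$ such that $\mathcal{F}_p:=\mathcal{F}(p)=K$ for some $p\in\mathbb{R}^d$. The number of simplices in $\mathcal{F}$ is the number of simplices of $K$. $\mathcal{F}$ is finite if $K$ is finite and for each $\sigma\in K$ there are finitely many points $q_1,\dots,q_{t(\sigma)}\in\mathbb{R}^d$ such that, for $p \in \mathbb{R}^d$, $\sigma\in\mathcal{F}_p$ iff $q_i\le p$ for some $i$. Intervals. An interval of a poset $P$ is a nonempty subset $I\subseteq P$ that is convex ($p,q\in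 I$, $p\le r\le q$ imply $r\in I$) and connected (any $p,q\in I$ are joined by a finite sequence in $I$ whose consecutive elements are comparable). $\mathrm{Int}(P)$ is the set of intervals of $P$. Generalized rank invariant. For a connected poset $P$ and a $P$-module $M$, with limit $(\varprojlim M,(\pi_p)_{p})$ and colimit $(\varinjlim M,(i_p)_{p})$, the map $\psi_M:=i_p\circ\pi_p:\varprojlim M\to\varinjlim M$ does not depend on $p\in P$; put $\mathrm{rank}(M):=\mathrm{rank}(\psi_M)$. The generalized rank invariant of a $P$-module $M$ is $\mathrm{rk}_M:\mathrm{Int}(P)\to\mathbb{Z}_{\ge 0}$, $I\mapsto\mathrm{rank}(M|_I)$. Generalized persistence diagram (GPD). The GPD of $M$ is the function $\mathrm{dgm}_M:\mathrm{Int}(P)\to\mathbb{Z}$ satisfying, for all $I\in\mathrm{Int}(P)$, $\mathrm{rk}_M(I)=\sum_{J\in\mathrm{Int}(P),\,J\supseteq I}\mathrm{dgm}_M(J)$, where the right-hand side has only finitely many nonzero summands. For a finite filtration $\mathcal{F}$ over $\mathbb{R}^d$ the module $\mathrm{H}_m(\mathcal{F};\mathbb{F}):\mathbb{R}^d\to\mathbf{vec}_{\mathbb{F}}$ (simplicial homology) is finitely presentable, and it is known that its GPD then exists, is unique and is finitely supported; it is denoted $\mathrm{dgm}_m(\mathcal{F})$. Its size is $\|\mathrm{dgm}_m(\mathcal{F})\|:=|\{I\in\mathrm{Int}(\mathbb{R}^d):\mathrm{dgm}_m(\mathcal{F})(I)\ne 0\}|$. *)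

(* Defs.v *)
From HB Require Import structures.
From mathcomp Require Import all_boot all_order all_algebra ring_quotient.
From mathcomp Require Import generic_quotient finmap.
From mathcomp Require Import all_classical reals.

Set Implicit Arguments.
Unset Strict Implicit.
Unset Printing Implicit Defensive.

Import Order.TTheory GRing.Theory Num.Theory.
Local Open Scope classical_set_scope.
Local Open Scope ring_scope.

(* Quotient of a module by a submodule, on top of the Z-module quotient of
   ring_quotient. *)
Section QuotientModule.
Context (F : fieldType) (U : lmodType F) (S : submodClosed U).
Local Open Scope quotient_scope.

Definition quot_pred : {pred U} := fun x => x \in S.

Fact quot_pred_zmod_closed : zmod_closed quot_pred.
Proof.
split=> [|x y].
  exact: (rpred0 S).
move=> Sx Sy; rewrite -scaleN1r; apply: (@rpredD _ S) => //.
by apply: (@rpredZ _ _ S).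
Qed.
HB.instance Definition _ :=
  GRing.isZmodClosed.Build U quot_pred quot_pred_zmod_closed.

Definition lmod_quot : Type := Quotient.quot quot_pred.
HB.instance Definition _ := GRing.Zmodule.on lmod_quot.

Definition qpi (x : U) : lmod_quot := \pi_(Quotient.quot quot_pred) x.

Lemma qpi_eq x y : qpi x = qpi y <-> x - y \in S.
Proof.
have -> : (x - y \in S) = (x - y \in quot_pred) by [].
by rewrite Quotient.idealrBE; split => [/eqP//|/eqP].
Qed.

Lemma qpi_surj (x : lmod_quot) : exists y, qpi y = x.
Proof. by exists (repr (x : Quotient.quot quot_pred)); rewrite /qpi reprK. Qed.

Lemma qpiD : {morph qpi : x y / x + y}.
Proof. by move=> x y; rewrite /qpi raddfD. Qed.

Definition lmod_quot_scale (a : F) (x : lmod_quot) : lmod_quot :=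
  qpi (a *: repr (x : Quotient.quot quot_pred)).

Lemma qpiZ a x : qpi (a *: x) = lmod_quot_scale a (qpi x).
Proof.
apply/qpi_eq; rewrite -scalerBr rpredZ //; apply/qpi_eq.
by rewrite /qpi reprK.
Qed.

Fact lmod_quot_scaleA a b (x : lmod_quot) :
  lmod_quot_scale a (lmod_quot_scale b x) = lmod_quot_scale (a * b) x.
Proof. by have [y <-] := qpi_surj x; rewrite -!qpiZ scalerA. Qed.
Fact lmod_quot_scale1 : left_id 1 lmod_quot_scale.
Proof. by move=> x; have [y <-] := qpi_surj x; rewrite -qpiZ scale1r. Qed.
Fact lmod_quot_scaleDr : right_distributive lmod_quot_scale +%R.
Proof.
move=> a x y; have [x' <-] := qpi_surj x; have [y' <-] := qpi_surj y.
by rewrite -qpiD -!qpiZ -qpiD scalerDr.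
Qed.
Fact lmod_quot_scaleDl x :
  {morph lmod_quot_scale^~ x : a b / a + b}.
Proof.
by move=> a b; have [x' <-] := qpi_surj x; rewrite -!qpiZ -qpiD scalerDl.
Qed.
HB.instance Definition _ := GRing.Zmodule_isLmodule.Build F lmod_quot
  lmod_quot_scaleA lmod_quot_scale1 lmod_quot_scaleDr lmod_quot_scaleDl.

Fact qpi_is_linear : linear qpi.
Proof. by move=> a x y; rewrite qpiD qpiZ. Qed.
HB.instance Definition _ := GRing.isLinear.Build F U lmod_quot _ qpi qpi_is_linear.

End QuotientModule.


HB.instance Definition _ (d : Order.disp_t) (P : porderType d) (A : set P) :=
  [SubChoice_isSubPOrder of {x : P | x \in A} by <: with d].

(* A P-module: a functor from the poset P, seen as a category, to the
   finite-dimensional F-vector spaces.  Morphisms p -> q are the proofs of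
   p <= q, which are unique since <= is boolean. *)
Record pmodule (F : fieldType) (d : Order.disp_t) (P : porderType d) := PModule {
  pm_obj :> P -> vectType F;
  pm_map : forall p q, (p <= q)%O -> 'Hom(pm_obj p, pm_obj q);
  pm_map_id : forall p (pp : (p <= p)%O) v, pm_map pp v = v;
  pm_map_comp : forall p q r (pq : (p <= q)%O) (qr : (q <= r)%O)
    (pr : (p <= r)%O) v, pm_map pr v = pm_map qr (pm_map pq v) }.

Definition pm_restrict (F : fieldType) (d : Order.disp_t) (P : porderType d)
    (M : pmodule F P) (A : set P) : pmodule F (set_type A) :=
  @PModule F d (set_type A) (fun p => M (val p))
    (fun p q pq => @pm_map _ _ _ M (val p) (val q) pq)
    (fun p pp v => @pm_map_id _ _ _ M (val p) pp v)
    (fun p q r pq qr pr v =>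
       @pm_map_comp _ _ _ M (val p) (val q) (val r) pq qr pr v).

(* The limit is the module of compatible families in the product of the M p, and
   the colimit is the quotient of the direct sum of the M p by the relations
   v ~ M(p <= q) v.  Neither needs be finite-dimensional when P is infinite, so
   both are plain F-modules. *)
Section LimitColimit.
Context (F : fieldType) (d : Order.disp_t) (P : porderType d) (M : pmodule F P).

Definition pprod : Type := forall p, M p.

HB.instance Definition _ := gen_eqMixin pprod.
HB.instance Definition _ := gen_choiceMixin pprod.

Let pprod_add (x y : pprod) : pprod := fun p => x p + y p.
Let pprod_opp (x : pprod) : pprod := fun p => - x p.
Let pprod_zero : pprod := fun p => 0.
Let pprod_scale (a : F) (x : pprod) : pprod := fun p => a *: x p.

Fact pprod_addA : associative pprod_add.
Proof. by move=> x y z; apply: functional_extensionality_dep => p; exact: addrA. Qed.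
Fact pprod_addC : commutative pprod_add.
Proof. by move=> x y; apply: functional_extensionality_dep => p; exact: addrC. Qed.
Fact pprod_add0 : left_id pprod_zero pprod_add.
Proof. by move=> x; apply: functional_extensionality_dep => p; exact: add0r. Qed.
Fact pprod_addN : left_inverse pprod_zero pprod_opp pprod_add.
Proof. by move=> x; apply: functional_extensionality_dep => p; exact: addNr. Qed.
HB.instance Definition _ :=
  GRing.isZmodule.Build pprod pprod_addA pprod_addC pprod_add0 pprod_addN.

Fact pprod_scaleA a b x : pprod_scale a (pprod_scale b x) = pprod_scale (a * b) x.
Proof. by apply: functional_extensionality_dep => p; exact: scalerA. Qed.
Fact pprod_scale1 : left_id 1 pprod_scale.
Proof. by move=> x; apply: functional_extensionality_dep => p; exact: scale1r. Qed.
Fact pprod_scaleDr : right_distributive pprod_scale +%R.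
Proof. by move=> a x y; apply: functional_extensionality_dep => p; exact: scalerDr. Qed.
Fact pprod_scaleDl x : {morph pprod_scale^~ x : a b / a + b}.
Proof. by move=> a b; apply: functional_extensionality_dep => p; exact: scalerDl. Qed.
HB.instance Definition _ := GRing.Zmodule_isLmodule.Build F pprod
  pprod_scaleA pprod_scale1 pprod_scaleDr pprod_scaleDl.

Lemma pprodD (x y : pprod) p : (x + y) p = x p + y p. Proof. by []. Qed.
Lemma pprodZ a (x : pprod) p : (a *: x) p = a *: x p. Proof. by []. Qed.

Definition lim_pred : {pred pprod} := fun x =>
  `[< forall p q (pq : (p <= q)%O), pm_map M pq (x p) = x q >].

Fact lim_pred_closed : submod_closed lim_pred.
Proof.
split=> [|a x y /asboolP cx /asboolP cy]; apply/asboolP => p q pq.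
  by rewrite linear0.
by rewrite !(pprodD, pprodZ) linearP /= cx cy.
Qed.
HB.instance Definition _ := GRing.isSubmodClosed.Build F pprod lim_pred lim_pred_closed.

Record lim := Lim { lim_val :> pprod; _ : lim_val \in lim_pred }.
HB.instance Definition _ := [isSub for lim_val].
HB.instance Definition _ := [Choice of lim by <:].
HB.instance Definition _ := [SubChoice_isSubZmodule of lim by <:].
HB.instance Definition _ := [SubZmodule_isSubLmodule of lim by <:].

Definition lim_proj (p : P) (x : lim) : M p := lim_val x p.

Definition dsum_pred : {pred pprod} := fun x =>
  `[< finite_set [set p | x p != 0] >].

Fact dsum_pred_closed : submod_closed dsum_pred.
Proof.
split=> [|a x y /asboolP fx /asboolP fy]; apply/asboolP.
  apply: (@sub_finite_set _ _ set0) => // p /=.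
  by rewrite [X in X != _](_ : _ = 0) // eqxx.
apply: (@sub_finite_set _ _ ([set p | x p != 0] `|` [set p | y p != 0])).
  move=> p /=; rewrite !(pprodD, pprodZ) => xy.
  have [x0|] := eqVneq (x p) 0; last by left.
  by right; move: xy; rewrite x0 scaler0 add0r.
by rewrite finite_setU.
Qed.
HB.instance Definition _ := GRing.isSubmodClosed.Build F pprod dsum_pred dsum_pred_closed.

Record dsum := DSum { dsum_val :> pprod; _ : dsum_val \in dsum_pred }.
HB.instance Definition _ := [isSub for dsum_val].
HB.instance Definition _ := [Choice of dsum by <:].
HB.instance Definition _ := [SubChoice_isSubZmodule of dsum by <:].
HB.instance Definition _ := [SubZmodule_isSubLmodule of dsum by <:].

Definition single_fun (p : P) (v : M p) : pprod := @dfwith P (fun q => M q) (fun=> 0) p v.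

Fact single_subproof p (v : M p) : single_fun v \in dsum_pred.
Proof.
apply/asboolP; apply: (@sub_finite_set _ _ [set p]); last exact: finite_set1.
move=> q /=; rewrite /single_fun; have [->//|qp] := eqVneq q p.
by rewrite dfwithout 1?eq_sym // eqxx.
Qed.

Definition single (p : P) (v : M p) : dsum := DSum (single_subproof v).

Fact single_is_linear p : linear (@single p).
Proof.
move=> a u v; apply: val_inj; apply: functional_extensionality_dep => q.
rewrite /= pprodD pprodZ /= /single_fun.
have [->|qp] := eqVneq q p; first by rewrite !dfwithin.
by rewrite !dfwithout 1?eq_sym // scaler0 addr0.
Qed.
HB.instance Definition _ p :=
  GRing.isLinear.Build F (M p) dsum _ (@single p) (@single_is_linear p).

Definition colim_rel (x : dsum) : Prop :=
  exists p q (pq : (p <= q)%O) (v : M p), x = single v - single (pm_map M pq v).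

(* The generators colim_rel are stable under scaling, so that their finite sums
   are already their linear span. *)
Definition colim_pred : {pred dsum} := fun x =>
  `[< exists2 s : seq dsum, (forall y, y \in s -> colim_rel y)
                          & x = \sum_(y <- s) y >].

Fact colim_pred_closed : submod_closed colim_pred.
Proof.
split=> [|a x y /asboolP[s sP ->] /asboolP[t tP ->]]; apply/asboolP.
  by exists [::] => //; rewrite big_nil.
exists ([seq a *: z | z <- s] ++ t) => [z|]; last first.
  by rewrite big_cat big_map scaler_sumr.
rewrite mem_cat => /orP[/mapP[z' /sP[p [q [pq [v ->]]]] ->]|/tP//].
by exists p, q, pq, (a *: v); rewrite scalerBr !linearZ.
Qed.
HB.instance Definition _ :=
  GRing.isSubmodClosed.Build F dsum colim_pred colim_pred_closed.

Definition colim : lmodType F := lmod_quot colim_pred.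

Definition colim_inj (p : P) (v : M p) : colim := qpi colim_pred (single v).

Definition psi (p : P) (x : lim) : colim := colim_inj (lim_proj p x).

Fact psi_is_linear p : linear (psi p).
Proof. by move=> a x y; rewrite /psi /colim_inj /lim_proj /= !linearP. Qed.
HB.instance Definition _ p := GRing.isLinear.Build F lim colim _ (psi p) (psi_is_linear p).

End LimitColimit.
Arguments psi {F d P} M p x.
Arguments lim_proj {F d P M} p x.
Arguments colim_inj {F d P M} p v.

Section LinearRank.
Context (F : fieldType) (U W : lmodType F).

Definition image_basis (f : U -> W) (n : nat) (b : 'I_n -> W) : Prop :=
  [/\ forall i, exists x, b i = f x,
      forall c : 'I_n -> F, \sum_i c i *: b i = 0 -> forall i, c i = 0
    & forall x, exists c : 'I_n -> F, f x = \sum_i c i *: b i].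

(* Dimension of the image of f.  The default 0 is only reached by maps of
   infinite rank; the maps psi M p factor through the finite-dimensional
   space M p, hence have finite rank. *)
Definition lin_rank (f : {linear U -> W}) : nat :=
  xget 0%N [set n | exists b : 'I_n -> W, image_basis f b].

End LinearRank.

Section Intervals.
Context (d : Order.disp_t) (P : porderType d).

Definition order_convex (I : set P) : Prop :=
  forall p q r, I p -> I q -> (p <= r <= q)%O -> I r.

Definition order_connected (I : set P) : Prop :=
  forall p q, I p -> I q -> exists s : seq P,
    [/\ forall r, r \in s -> I r, path (fun x y => x >=< y)%O p s & last p s = q].

Definition Int : set (set P) :=
  [set I | [/\ I !=set0, order_convex I & order_connected I]].

Lemma Int_nonempty (I : Int) : exists p : P, p \in val I.
Proof. by case: I => I /= /set_mem[[p Ip] _ _]; exists p; exact: mem_set. Qed.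

Definition Int_point (I : Int) : set_type (val I) :=
  let: exist p Ip := cid (Int_nonempty I) in exist _ p Ip.

End Intervals.
Arguments Int {d} P.

Lemma psi_comparable (F : fieldType) (d : Order.disp_t) (P : porderType d)
    (M : pmodule F P) p q : (p >=< q)%O -> psi M p =1 psi M q.
Proof.
suff H p' q' : (p' <= q')%O -> psi M p' =1 psi M q'.
  by case/orP => [/H//|/H h x]; rewrite h.
move=> pq x; apply/qpi_eq; apply/asboolP.
exists [:: single (lim_proj p' x) - single (lim_proj q' x)].
  move=> y; rewrite inE => /eqP ->; exists p', q', pq, (lim_proj p' x).
  by case: x => x /= /asboolP ->.
by rewrite big_seq1.
Qed.

(* rank (psi M p); for connected P the base point p is immaterial, by
   psi_comparable. *)
Definition gen_rank (F : fieldType) (d : Order.disp_t) (P : porderType d)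
    (M : pmodule F P) (p : P) : nat := lin_rank (psi M p).

Section GeneralizedRank.
Context (F : fieldType) (d : Order.disp_t) (P : porderType d).

Lemma psi_indep (M : pmodule F P) (I : Int P) (p q : set_type (val I)) :
  psi (pm_restrict M (val I)) p =1 psi (pm_restrict M (val I)) q.
Proof.
case: p q => p Ip [q Iq]; have [_ _ co] := set_mem (valP I).
have [s [sI ps qs]] := co p q (set_mem Ip) (set_mem Iq).
elim: s p Ip sI ps qs => [|r s IH] p Ip sI /=.
  by move=> _ pq; case: _ / pq in Iq *; rewrite (bool_irrelevance Ip Iq).
move=> /andP[pr rs] qs x.
have Ir : r \in val I by apply/mem_set/sI; rewrite mem_head.
rewrite (@psi_comparable _ _ _ _ _ (exist _ r Ir)) //.
by apply: IH => // t ts; apply: sI; rewrite inE ts orbT.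
Qed.

(* The base point chosen in the interval I is immaterial by psi_indep. *)
Definition rk (M : pmodule F P) (I : Int P) : nat :=
  gen_rank (pm_restrict M (val I)) (Int_point I).

(* \sum_(J \in A) is a sum over the support of the summand, equal to 0 if that
   support is infinite: finiteness is required separately. *)
Definition is_gpd (M : pmodule F P) (D : Int P -> int) : Prop :=
  forall I : Int P,
    finite_set [set J : Int P | val I `<=` val J /\ D J != 0] /\
    (rk M I)%:Z = \sum_(J \in [set J : Int P | val I `<=` val J]) D J.

(* If no function satisfies is_gpd then gpd M is the zero function, and if the
   support of gpd M is infinite then gpd_size M is 0; neither happens for the
   homology modules of finite filtrations. *)
Definition gpd (M : pmodule F P) : Int P -> int :=
  xget (fun=> 0) [set D | is_gpd M D].

Definition gpd_size (M : pmodule F P) : nat :=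
  #|` fset_set [set I : Int P | gpd M I != 0] |.

End GeneralizedRank.

(* The quotient Z / (Z :&: B) of two subspaces, as a vector space. *)
Section QuotientSpace.
Context (F : fieldType) (vT : vectType F) (Z B : {vspace vT}).

Definition vquot_pred : {pred subvs_of Z} := fun z => vsval z \in B.

Fact vquot_pred_closed : submod_closed vquot_pred.
Proof.
split=> [|a x y]; first exact: mem0v.
by move=> Bx By; exact: memvD (memvZ a Bx) By.
Qed.
HB.instance Definition _ :=
  GRing.isSubmodClosed.Build F (subvs_of Z) vquot_pred vquot_pred_closed.

Definition vquot : Type := lmod_quot vquot_pred.
HB.instance Definition _ := GRing.Lmodule.on vquot.

Definition vpi : subvs_of Z -> vquot := qpi vquot_pred.
HB.instance Definition _ := GRing.Linear.on vpi.

Lemma vpi_eq x y : vpi x = vpi y <-> vsval x - vsval y \in B.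
Proof. exact: qpi_eq. Qed.

Lemma vpi_surj (x : vquot) : exists y, vpi y = x.
Proof. exact: qpi_surj. Qed.

Definition vrepr (x : vquot) : subvs_of Z := projT1 (cid (vpi_surj x)).

Lemma vreprK : cancel vrepr vpi.
Proof. by move=> x; rewrite /vrepr; case: cid. Qed.

Lemma vquot_vect_iso : Vector.axiom (\dim (Z :\: B)) vquot.
Proof.
pose C := (Z :\: B)%VS; pose pr := addv_pi1 Z B.
have CZ : (C <= Z)%VS by exact: diffvSl.
have prC z : pr z \in C by exact: memv_pi.
have prK z : z \in C -> pr z = z by apply: daddv_pi_id; exact: capv_diff.
have prZ z : z \in Z -> pr z - z \in B.
  move=> Zz; have zZB : z \in (Z + B)%VS by rewrite (subvP (addvSl Z B)).
  by rewrite -{2}(addv_pi1_pi2 zZB) opprD addNKr memvN memv_pi2.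
have prB z : z \in B -> pr z = 0.
  move=> Bz; have zZB : z \in (Z + B)%VS by rewrite (subvP (addvSr Z B)).
  by apply: (addIr (addv_pi2 Z B z)); rewrite addv_pi1_pi2 // addv_pi2_id // add0r.
pose pq (x : vquot) := pr (vsval (vrepr x)).
have pq_pi z : pq (vpi z) = pr (vsval z).
  apply/eqP; rewrite -subr_eq0 -linearB; apply/eqP/prB/vpi_eq.
  exact: vreprK.
have pq_lin : linear pq.
  move=> a x y; have [x' <-] := vpi_surj x; have [y' <-] := vpi_surj y.
  by rewrite -linearP !pq_pi /= linearP.
exists (fun x => \row_i coord (vbasis C) i (pq x)).
  by move=> a x y; apply/rowP => i; rewrite !mxE pq_lin linearP.
exists (fun r : 'rV_(\dim C) => vpi (vsproj Z (\sum_i r 0 i *: (vbasis C)`_i))).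
  move=> x; have [z <-] := vpi_surj x; apply/vpi_eq.
  rewrite (eq_bigr (fun i => coord (vbasis C) i (pq (vpi z)) *: (vbasis C)`_i)).
    by rewrite pq_pi -coord_vbasis // vsprojK ?prZ ?subvsP // (subvP CZ).
  by move=> i _; rewrite mxE.
move=> r; set w := \sum_i _; have Cw : w \in C.
  by apply: rpred_sum => j _; rewrite rpredZ ?vbasis_mem ?memt_nth.
apply/rowP => i; rewrite mxE pq_pi vsprojK ?(subvP CZ) // prK //.
by rewrite coord_sum_free ?(basis_free (vbasisP C)).
Qed.
HB.instance Definition _ := Lmodule_hasFinDim.Build F vquot vquot_vect_iso.

End QuotientSpace.

Section QuotientMap.
Context (F : fieldType) (vT : vectType F).
Implicit Types Z B : {vspace vT}.

Definition vquot_fun Z B Z' B' (x : vquot Z B) : vquot Z' B' :=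
  vpi B' (vsproj Z' (vsval (vrepr x))).

(* [z] |-> [z], which is well defined when Z <= Z' and B <= B'; the value has no
   meaning otherwise. *)
Definition vquot_map Z B Z' B' : 'Hom(vquot Z B, vquot Z' B') :=
  linfun (@vquot_fun Z B Z' B').

Lemma vquot_mapE Z B Z' B' (z : subvs_of Z) :
    (Z <= Z')%VS -> (B <= B')%VS ->
  vquot_map Z B Z' B' (vpi B z) = vpi B' (vsproj Z' (vsval z)).
Proof.
move=> ZZ' BB'.
have funE y : @vquot_fun Z B Z' B' (vpi B y) = vpi B' (vsproj Z' (vsval y)).
  rewrite /vquot_fun; apply/vpi_eq; rewrite !vsprojK ?(subvP ZZ') ?subvsP //.
  by apply: (subvP BB'); apply/vpi_eq; exact: vreprK.
have fun_lin : linear (@vquot_fun Z B Z' B').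
  move=> a x y; have [x' <-] := vpi_surj x; have [y' <-] := vpi_surj y.
  by rewrite -linearP !funE [vsval _]linearP !linearP.
pose f : {linear vquot Z B -> vquot Z' B'} := HB.pack (@vquot_fun Z B Z' B')
  (GRing.isLinear.Build F (vquot Z B) (vquot Z' B') _ _ fun_lin).
by rewrite /vquot_map (lfunE f) /= funE.
Qed.

Lemma vquot_map_id Z B x : vquot_map Z B Z B x = x.
Proof. by have [z <-] := vpi_surj x; rewrite vquot_mapE // vsvalK. Qed.

Lemma vquot_map_comp Z1 B1 Z2 B2 Z3 B3 x :
    (Z1 <= Z2)%VS -> (B1 <= B2)%VS -> (Z2 <= Z3)%VS -> (B2 <= B3)%VS ->
  vquot_map Z1 B1 Z3 B3 x = vquot_map Z2 B2 Z3 B3 (vquot_map Z1 B1 Z2 B2 x).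
Proof.
move=> Z12 B12 Z23 B23; have [z <-] := vpi_surj x.
rewrite !vquot_mapE ?(subv_trans Z12) ?(subv_trans B12) //.
by rewrite vsprojK // (subvP Z12) ?subvsP.
Qed.

End QuotientMap.

(* Simplices are nonempty, and not every element of V has to be a vertex: finite
   complexes are the finite sets of finite sets closed under nonempty subsets. *)
Definition simplicial_complex (V : finType) (K : {set {set V}}) : Prop :=
  finset.set0 \notin K /\
  forall s t : {set V}, s \in K -> t \subset s -> t != finset.set0 -> t \in K.

Section SimplicialHomology.
Context (F : fieldType) (V : finType).

(* Chains of all degrees in the full simplex on V; the value at s is the
   coefficient of s, oriented by the enumeration order of V. *)
Definition chain : vectType F := {ffun {set V} -> F^o}.

(* Incidence number of the face t of v |: t, for v not in t: (-1)^i where i is the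
   position of v in the ordered list of vertices of v |: t. *)
Definition incidence (v : V) (t : {set V}) : F :=
  (-1) ^+ #|[pred w in t | (enum_rank w < enum_rank v)%N]|.

(* Unreduced: the boundary has no component on the empty set. *)
Definition boundary_fun (c : chain) : chain :=
  [ffun t : {set V} => if t == finset.set0 then 0
    else \sum_(v | v \notin t) incidence v t * c (v |: t)].

Fact boundary_linear : linear boundary_fun.
Proof.
move=> a x y; apply/ffunP => t; rewrite !ffunE.
case: ifP => _; first by rewrite scaler0 addr0.
rewrite scaler_sumr -big_split; apply: eq_bigr => v _ /=.
by rewrite !ffunE mulrDr /GRing.scale /= mulrCA.
Qed.
HB.instance Definition _ :=
  GRing.isLinear.Build F chain chain _ boundary_fun boundary_linear.

Definition boundary : 'End(chain) := linfun boundary_fun.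

Definition elem_chain (s : {set V}) : chain := [ffun t => (t == s)%:R].

Definition chains (n : nat) (L : {set {set V}}) : {vspace chain} :=
  (\sum_(s in L | #|s| == n.+1) <[elem_chain s]>)%VS.

Definition cycles n L : {vspace chain} := (chains n L :&: lker boundary)%VS.
Definition boundaries n L : {vspace chain} := (boundary @: chains n.+1 L)%VS.
Definition homology n L : vectType F := vquot (cycles n L) (boundaries n L).

Lemma chainsS n (L L' : {set {set V}}) :
  L \subset L' -> (chains n L <= chains n L')%VS.
Proof.
move=> /fintype.subsetP LL'; apply/subv_sumP => s /andP[sL sn].
by apply: (sumv_sup s); rewrite ?LL'.
Qed.

Lemma cyclesS n (L L' : {set {set V}}) :
  L \subset L' -> (cycles n L <= cycles n L')%VS.
Proof. by move=> LL'; apply: capvS; [exact: chainsS|exact: subvv]. Qed.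

Lemma boundariesS n (L L' : {set {set V}}) :
  L \subset L' -> (boundaries n L <= boundaries n L')%VS.
Proof. by move=> LL'; apply: limgS; exact: chainsS. Qed.

Definition homology_map n L L' : 'Hom(homology n L, homology n L') :=
  vquot_map (cycles n L) (boundaries n L) (cycles n L') (boundaries n L').

Lemma homology_map_id n L x : homology_map n L L x = x.
Proof. exact: vquot_map_id. Qed.

Lemma homology_map_comp n (L L' L'' : {set {set V}}) x :
    L \subset L' -> L' \subset L'' ->
  homology_map n L L'' x = homology_map n L' L'' (homology_map n L L' x).
Proof.
by move=> LL' L'L''; apply: vquot_map_comp; rewrite ?cyclesS ?boundariesS.
Qed.

End SimplicialHomology.

(* R^d with the product order is d.-tupleprod R. *)
Record filtration (R : realType) (d : nat) (V : finType) := Filtration {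
  fil_total : {set {set V}};
  fil_at :> d.-tupleprod R -> {set {set V}};
  fil_total_complex : simplicial_complex fil_total;
  fil_at_complex : forall p, simplicial_complex (fil_at p);
  fil_at_sub : forall p, fil_at p \subset fil_total;
  fil_mono : forall p q, (p <= q)%O -> fil_at p \subset fil_at q;
  fil_exhaust : exists p, fil_at p = fil_total }.

Definition finite_filtration (R : realType) (d : nat) (V : finType)
    (X : filtration R d V) : Prop :=
  forall s, s \in fil_total X -> exists q : seq (d.-tupleprod R),
    forall p, s \in X p <-> exists2 q0, q0 \in q & (q0 <= p)%O.

Definition num_simplices (R : realType) (d : nat) (V : finType)
    (X : filtration R d V) : nat := #|fil_total X|.

Definition homology_module (F : fieldType) (R : realType) (d : nat) (V : finType)
    (n : nat) (X : filtration R d V) : pmodule F (d.-tupleprod R) :=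
  @PModule F _ (d.-tupleprod R) (fun p => homology F n (X p))
    (fun p q _ => homology_map F n (X p) (X q))
    (fun p _ v => homology_map_id v)
    (fun p q r pq qr _ v => homology_map_comp v (fil_mono X pq) (fil_mono X qr)).

(* Main.v *)
Require Import Defs.
From HB Require Import structures.
From mathcomp Require Import all_boot all_order all_algebra.
From mathcomp Require Import all_classical reals finmap.
From mathcomp Require Import ring zify.

(** Two facts make generalized persistence diagrams computable here.

    First, suppose that a module M on a connected poset is a quotient of a
    constant module W, say M p = W / R p.  The constant families already map
    onto the colimit, which is W divided by the sum of the R p; so the
    generalized rank of M is the codimension of that sum
    ([gen_rank_quotient]), however complicated the shape of the
    poset is.  In a filtration in which all m-cycles are present from the start,
    the m-th homology is of this kind, and its rank over an interval I is the
    dimension of the cycles minus that of the boundaries of the union of the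
    complexes met by I ([homology_rk]).

    Second, if the rank function is a combination of the functions
    I |-> [I is included in C t], for finitely many distinct intervals C t,
    then the coefficients are the diagram ([gpd_size_comb]), because a diagram
    is determined by the ranks ([gpd_unique]).

    So let n simplices tau 0, ..., tau (n-1) of dimension m+1 enter at pairwise
    incomparable points b 0, ..., b (n-1) of R^d, everything else entering at
    0, and suppose that the only relation between their boundaries, modulo
    the boundaries already present at 0, involves all of them.  If S is the set
    of the i such that I meets the points above b i, then the rank at I is
      constant - #|S| + [S is everything]
    as soon as I lies above 0, and it is 0 otherwise.  Now #|S| and
    [S is everything] are combinations of the functions [S is disjoint from T],
    the second one being the alternating sum over all subsets T; and for
    I above 0, S is disjoint from T exactly when I is included in the interval
    C T of the points above 0 that are above no b i with i in T.  Hence every T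
    with at least two elements contributes an interval to the diagram, which
    has at least 2^n - n - 1 of them, whereas the number of simplices is
    polynomial in n for fixed m.

    The complex is obtained from a fan of n simplices of dimension m+2, the
    cells, in which consecutive cells share a facet, the wall between them.
    The walls between two cells cancel in the boundary of the sum of the
    cells, which is therefore a cycle that avoids them; it passes through all
    the tau i ([strip_sphere_chain], [strip_sphere_facet]), and this is the
    relation.  There is no other one because the face that tau (j-1) and
    tau j share has no further coface in the complex, so that the coefficients
    of a cycle at these two simplices vanish simultaneously
    ([strip_cycle_facet]).  For m = 0 the tau i are the edges of a path, whose
    ends are joined outside it to a common vertex. *)

Set Implicit Arguments.
Unset Strict Implicit.
Unset Printing Implicit Defensive.

Import Order.TTheory GRing.Theory Num.Theory.
Local Open Scope classical_set_scope.
Local Open Scope ring_scope.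

(** * Rank of a map between infinite-dimensional spaces *)

(** The coordinates of b' in b form a matrix whose rows are independent, so it
    has at least as many columns as rows. *)
Lemma image_basis_leq (F : fieldType) (U W : lmodType F) (f : U -> W) n n'
    (b : 'I_n -> W) (b' : 'I_n' -> W) :
  image_basis f b -> image_basis f b' -> (n' <= n)%N.
Proof.
move=> [_ _ bspan] [b'im b'free _].
have /choice[A Ab] j : exists c : 'I_n -> F, b' j = \sum_i c i *: b i.
  by have [x ->] := b'im j; exact: bspan.
have: row_free (\matrix_(j, i) A j i).
  apply: inj_row_free => c cA0; apply/rowP => j; rewrite mxE.
  apply: (b'free (fun j => c 0 j)).
  under eq_bigr => k _ do rewrite Ab scaler_sumr.
  rewrite exchange_big big1 // => i _.
  under eq_bigr => k _ do rewrite scalerA.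
  rewrite -scaler_suml; move/rowP/(_ i): cA0; rewrite !mxE.
  by under eq_bigr => k _ do rewrite mxE; move=> ->; rewrite scale0r.
by move=> /eqP <-; exact: rank_leq_col.
Qed.

Lemma lin_rankE (F : fieldType) (U W : lmodType F) (f : {linear U -> W}) n
    (b : 'I_n -> W) :
  image_basis f b -> lin_rank f = n.
Proof.
move=> fb; rewrite /lin_rank; case: xgetP => [n' _ [b' fb']|/(_ n)]; last first.
  by case; exists b.
by apply/eqP; rewrite eqn_leq (image_basis_leq fb fb') (image_basis_leq fb' fb).
Qed.

(** The form in which ranks are computed: f itself may start from an
    infinite-dimensional space, but a map g from a finite-dimensional one has
    the same image, and a basis of a complement of its kernel gives a basis of
    that image. *)
Lemma lin_rank_quotient (F : fieldType) (U W : lmodType F)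
    (f : {linear U -> W}) (T : vectType F) (g : {linear T -> W})
    (K : {vspace T}) :
    (forall t, exists x, f x = g t) -> (forall x, exists t, f x = g t) ->
    (forall t, t \in K <-> g t = 0) ->
  lin_rank f = (\dim {:T} - \dim K)%N.
Proof.
move=> fg gf kerg; rewrite -dimv_compl.
set C := (K^C)%VS.
apply: (@lin_rankE _ _ _ _ _ (fun i => g (vbasis C)`_i)); split.
- by move=> i; have [x <-] := fg (vbasis C)`_i; exists x.
- move=> c; under eq_bigr do rewrite -linearZ; rewrite -linear_sum.
  move=> /kerg Kc.
  have /eqP : \sum_i c i *: (vbasis C)`_i == 0.
    rewrite -memv0 -(capv_compl K) memv_cap Kc.
    by apply: rpred_sum => j _; rewrite rpredZ ?vbasis_mem ?memt_nth.
  by move/freeP: (basis_free (vbasisP C)); apply.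
- move=> x; have [t ->] := gf x.
  have : t \in (K + C)%VS by rewrite addv_complf memvf.
  move=> /memv_addP[k Kk [c Cc ->]]; exists (fun i => coord (vbasis C) i c).
  rewrite linearD (iffLR (kerg k) Kk) add0r {1}(coord_vbasis Cc) linear_sum.
  by under eq_bigr do rewrite linearZ.
Qed.

Lemma lin_rank0 (F : fieldType) (U W : lmodType F) (f : {linear U -> W}) :
  (forall x, f x = 0) -> lin_rank f = 0%N.
Proof.
move=> f0; apply: (@lin_rankE _ _ _ _ _ (fun i : 'I_0 => 0)); split.
- by case.
- by move=> c _ [].
- by move=> x; exists (fun=> 0); rewrite big_ord0.
Qed.

(** * Generalized persistence diagrams *)

(** The index sets of the sums that define diagrams are infinite, and only the
    supports of the summands are finite. *)
Lemma fsbigD1_support (V : zmodType) (I : choiceType) (i : I) (A : set I)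
    (f : I -> V) :
    finite_set (A `&` [set j | f j != 0]) -> A i ->
  \sum_(j \in A) f j = f i + \sum_(j \in A `\ i) f j.
Proof.
move=> Afin Ai; set B := A `&` _ in Afin.
have out j : ~ B j -> A j -> f j = 0.
  by move=> nB Aj; apply/eqP; apply: contra_notT nB.
rewrite -(fsbig_widen (i |` B) A) /=.
- rewrite (fsbigD1 i) /=; [|by rewrite finite_setU; split|by left].
  congr (_ + _); apply: fsbig_widen => [j [[->//|[Aj _]] ij]|j [[Aj ij] nB]].
    by split.
  by apply: out => // Bj; apply: nB; split=> //; right.
- by move=> j [->//|[]].
- by move=> j [Aj nB]; apply: out => // Bj; apply: nB; right.
Qed.

Lemma fsumrD_support (V : zmodType) (I : choiceType) (A : set I) (f g : I -> V) :
    finite_set (A `&` [set j | f j != 0]) ->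
    finite_set (A `&` [set j | g j != 0]) ->
  \sum_(j \in A) (f j + g j) = \sum_(j \in A) f j + \sum_(j \in A) g j.
Proof.
move=> ffin gfin; set B := (A `&` [set j | f j != 0]) `|` (A `&` [set j | g j != 0]).
have BA : B `<=` A by move=> j [] [].
have out j : (A `\` B) j -> f j = 0 /\ g j = 0.
  by move=> [Aj nB]; split; apply/eqP; apply: contra_notT nB; [left|right].
rewrite -(fsbig_widen B A) //=; last first.
  by move=> j /out[fj gj] /=; rewrite fj gj addr0.
rewrite fsbig_split /=; last by rewrite finite_setU.
by congr (_ + _); apply: fsbig_widen => // j /out[].
Qed.

Section GPDUniqueness.
Context (F : fieldType) (d : Order.disp_t) (P : porderType d).

(** By induction on the number of J above I that are in the support of D or E:
    if I is one of them, then every J strictly above I has fewer, so the two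
    sums that give the rank at I agree outside the term at I. *)
Lemma gpd_unique (M : pmodule F P) (D E : Int P -> int) :
  is_gpd M D -> is_gpd M E -> D = E.
Proof.
move=> gD gE.
pose U (I : Int P) := [set J : Int P | val I `<=` val J /\ (D J != 0 \/ E J != 0)].
have Ufin I : finite_set (U I).
  have -> : U I = [set J | val I `<=` val J /\ D J != 0] `|`
                  [set J | val I `<=` val J /\ E J != 0].
    by apply/seteqP; split => J /=; rewrite /U /=; tauto.
  by rewrite finite_setU; split; [exact: (gD I).1|exact: (gE I).1].
apply/funext => I; have [n] := ubnP #|` fset_set (U I)|.
elim: n I => // n IH I ltn.
have [UI|] := pselect (U I I); last first.
  rewrite /U /= => nU; have [->|/eqP DI] := eqVneq (D I) 0.
    by have [->//|/eqP EI] := eqVneq (E I) 0; case: nU; split=> //; right; apply/eqP.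
  by case: nU; split=> //; left; apply/eqP.
have eqDE (J : Int P) : val I `<=` val J -> J <> I -> D J = E J.
  move=> IJ JI; apply: IH; rewrite -ltnS; apply: leq_trans ltn.
  rewrite ltnS; apply: fproper_ltn_card; rewrite fproperE; apply/andP; split.
    apply/fsubsetP => L; rewrite !in_fset_set // => /set_mem[JL ?].
    apply/mem_set; split=> //.
    exact: subset_trans JL.
  apply/fsubsetPn; exists I; first by rewrite in_fset_set //; exact/mem_set.
  rewrite in_fset_set //; apply: contra_notN JI => /set_mem[JI' _]; apply: val_inj.
  exact/seteqP.
have sumE D' : is_gpd M D' -> (rk M I)%:Z = D' I +
    \sum_(J \in [set J : Int P | val I `<=` val J] `\ I) D' J.
  move=> /(_ I)[fin ->]; exact: fsbigD1_support.
have := sumE _ gD; rewrite (sumE _ gE) => /esym.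
rewrite (eq_fsbigr E) => [/addIr//|J /set_mem[/= IJ JI]].
exact: eqDE.
Qed.

Lemma gpdE (M : pmodule F P) (D : Int P -> int) : is_gpd M D -> gpd M = D.
Proof.
move=> gD; rewrite /gpd; case: xgetP => [E _ gE|/(_ D)/(_ gD)//].
exact: gpd_unique gE gD.
Qed.

End GPDUniqueness.

Section GPDCombination.
Context (F : fieldType) (d : Order.disp_t) (P : porderType d).
Context (T : finType) (C : T -> Int P) (h : T -> int).

(** The fibre of C is summed over rather than inverted, to have a diagram
    without choosing preimages. *)
Definition comb_diagram (J : Int P) : int := \sum_(t | C t == J) h t.

Hypothesis C_inj : injective C.

Lemma comb_diagramE t : comb_diagram (C t) = h t.
Proof.
rewrite /comb_diagram (big_pred1 t) // => u; apply/eqP/eqP => [/C_inj//|->//].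
Qed.

Lemma comb_diagram_support (J : Int P) :
  comb_diagram J != 0 -> exists t, C t = J.
Proof.
apply: contraNP => /forallNP CJ; rewrite /comb_diagram big_pred0 // => t.
by apply/eqP/CJ.
Qed.

Lemma comb_diagram_finite : finite_set [set J | comb_diagram J != 0].
Proof.
apply: (@sub_finite_set _ _ (range C)) => [J /comb_diagram_support[t <-]|].
  by exists t.
exact/finite_image/finite_finset.
Qed.

Lemma comb_diagram_is_gpd (M : pmodule F P) :
    (forall I : Int P,
      (rk M I)%:Z = \sum_(t | `[< val I `<=` val (C t) >]) h t) ->
  is_gpd M comb_diagram.
Proof.
move=> rkE I; split.
  by apply: sub_finite_set comb_diagram_finite => J [].
rewrite rkE; set A := [set J | _].
pose B := [set t | val I `<=` val (C t)].
rewrite -(fsbig_widen (C @` B) A) /=.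
- rewrite fsbig_image; last by move=> t u _ _; exact: C_inj.
  under eq_fsbigr do rewrite comb_diagramE.
  rewrite (@bigfs _ _ _ _ (index_enum T)) ?index_enum_uniq //; last first.
    by move=> t _; rewrite mem_index_enum.
  apply: eq_fsbigl; apply/seteqP.
  by split=> t; rewrite /B /= => /asboolP.
- by move=> J [t Bt <-].
- move=> J [/= AJ nBJ]; apply/eqP; apply: contraPT nBJ.
  move=> /comb_diagram_support[t tJ].
  by rewrite /not; apply; exists t => //; rewrite /B /= tJ.
Qed.

(** Mobius inversion read backwards: an expression of the ranks by indicator
    functions of principal down-sets of intervals is already the diagram, and
    no sum over all the intervals has to be inverted. *)
Lemma gpd_size_comb (M : pmodule F P) :
    (forall I : Int P,
      (rk M I)%:Z = \sum_(t | `[< val I `<=` val (C t) >]) h t) ->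
  gpd_size M = #|[pred t | h t != 0]|.
Proof.
move=> /comb_diagram_is_gpd/gpdE gE; rewrite /gpd_size gE.
have -> : fset_set [set J | comb_diagram J != 0] =
    [fset C t | t in [pred t | h t != 0]]%fset.
  apply/fsetP => J; rewrite in_fset_set; last exact: comb_diagram_finite.
  apply/idP/imfsetP => /= [/set_mem DJ|[t ht ->]]; last first.
    by apply/mem_set; rewrite /= comb_diagramE.
  have [t tJ] := comb_diagram_support DJ; exists t => //.
  by move: DJ; rewrite unfold_in /= -tJ comb_diagramE.
by rewrite card_imfset //= -cardE.
Qed.

End GPDCombination.

(** * Quotients of constant modules *)

(** Here M is a quotient of the constant module W by means of the maps q p, and
    K stands for the sum of their kernels; it is required to be reached by
    finitely many of them. *)
Section QuotientOfConstant.
Context (F : fieldType) (d : Order.disp_t) (P : porderType d).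
Context (M : pmodule F P) (W : vectType F) (q : forall p, 'Hom(W, M p)).
Hypothesis q_nat : forall p r (pr : (p <= r)%O) w, pm_map M pr (q p w) = q r w.
Hypothesis q_surj : forall p v, exists w, q p w = v.

Fact const_family_lim w : (fun p => q p w : M p) \in @lim_pred F d P M.
Proof. by apply/asboolP => p r pr; exact: q_nat. Qed.

Definition const_family w : Defs.lim M := Lim (const_family_lim w).

Fact const_family_linear : linear const_family.
Proof.
move=> a u v; apply: val_inj; apply: functional_extensionality_dep => p /=.
by rewrite linearP.
Qed.
HB.instance Definition _ :=
  GRing.isLinear.Build F W (Defs.lim M) _ const_family const_family_linear.

Context (K : {vspace W}).
Hypothesis ker_sub : forall p, (lker (q p) <= K)%VS.

(** The colimit is no smaller than W / K: the maps M p -> W / K induced by the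
    identity of W are compatible, hence factor through the colimit. *)
Lemma colim_relation_eq0 p w : colim_inj p (q p w) = 0 -> w \in K.
Proof.
(* lam p is induced on M p by the projection of W along K, so that summing the
   lam p over a direct sum kills the relations of the colimit. *)
pose lift p (v : M p) := projT1 (cid (q_surj v)).
have liftK r (v : M r) : q r (lift r v) = v by rewrite /lift; case: cid.
pose pr : 'End(W) := (\1 - projv K)%VF.
have prE u : pr u = u - projv K u by rewrite add_lfunE opp_lfunE id_lfunE.
have prK u : u \in K -> pr u = 0.
  by move=> Ku; rewrite prE projv_id ?subrr.
pose lam r (v : M r) := pr (lift r v).
have lam_q r u : lam r (q r u) = pr u.
  apply/eqP; rewrite -subr_eq0 /lam -(linearB pr); apply/eqP/prK.
  apply: (subvP (ker_sub r)); rewrite memv_ker linearB /= liftK subrr //.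
have lamD r u v : lam r (u + v) = lam r u + lam r v.
  by rewrite -(liftK r u) -(liftK r v) -linearD !lam_q -linearD.
have lam0 r : lam r 0 = 0 by rewrite -(linear0 (q r)) lam_q linear0.
have lamN r u : lam r (- u) = - lam r u.
  by apply/eqP; rewrite -addr_eq0 -lamD addNr lam0.
pose e (x : dsum M) := \sum_(r \in [set: P]) lam r (dsum_val x r).
have supp (x : dsum M) :
    finite_set ([set: P] `&` [set r | lam r (dsum_val x r) != 0]).
  case: x => x /= /asboolP; apply: sub_finite_set => r [_] /=.
  by apply: contraNN => /eqP ->; rewrite lam0.
have eD x y : e (x + y) = e x + e y.
  rewrite /e -fsumrD_support //; apply: eq_fsbigr => r _ /=.
  by rewrite -lamD.
have e_single r v : e (single v) = lam r v.
  rewrite /e (fsbigD1_support (i := r) (supp (single v))) //=.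
  rewrite {1}/single_fun dfwithin fsbig1 ?addr0 // => s [_ /= sr].
  by rewrite /single_fun dfwithout ?lam0 //; apply/eqP => rs; apply: sr.
move=> qw0.
have /qpi_eq : qpi (@colim_pred F d P M) (single (q p w)) = qpi _ 0.
  by rewrite linear0.
rewrite subr0 => /asboolP[s srel swE].
have : e (single (q p w)) = 0.
  rewrite swE; elim: s {swE} srel => [|x s IH] srel.
    by rewrite big_nil /e fsbig1 // => r _; exact: lam0.
  rewrite big_cons eD IH ?addr0; last first.
    by move=> y ys; apply: srel; rewrite inE ys orbT.
  have [a [b [ab [v ->]]]] := srel x (mem_head _ _).
  rewrite -scaleN1r -linearZ eD !e_single scaleN1r lamN.
  by rewrite -(liftK a v) q_nat !lam_q subrr.
by rewrite e_single lam_q prE => /eqP; rewrite subr_eq0 => /eqP ->; exact: memv_proj.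
Qed.

Hypothesis psi_const : forall p r, psi M p =1 psi M r.
Context (s : seq P).
Hypothesis sub_ker : (K <= \sum_(p <- s) lker (q p))%VS.

Lemma psi_const_family p w : psi M p (const_family w) = colim_inj p (q p w).
Proof. by []. Qed.

(** The limit maps onto the image of W in the colimit, because psi only sees the
    component at p of a compatible family, and this component is also that of
    a constant family. *)
Lemma gen_rank_quotient p : gen_rank M p = (\dim {:W} - \dim K)%N.
Proof.
pose g : {linear W -> Defs.colim M} := psi M p \o const_family.
apply: (@lin_rank_quotient _ _ _ _ _ g) => [w|x|w]; last split.
- by exists (const_family w).
- by have [w qw] := q_surj (lim_proj p x); exists w; rewrite /= psi_const_family qw.
- have kerg r u : u \in lker (q r) -> g u = 0.
    rewrite memv_ker => /eqP qu.
    rewrite -[g u]/(psi M p (const_family u)) (psi_const p r) psi_const_family.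
    by rewrite qu /colim_inj !linear0.
  move=> /(subvP sub_ker); elim: s w => [|r t IH] w.
    by rewrite big_nil memv0 => /eqP ->; rewrite linear0.
  rewrite big_cons => /memv_addP[u Ku [v Kv ->]].
  by rewrite (linearD g) (kerg r) // IH // addr0.
- exact: colim_relation_eq0.
Qed.

End QuotientOfConstant.

(** * Simplicial chains, and generalized ranks of homology *)

Section ChainComplex.
Context (F : fieldType) (V : finType).
Implicit Types (L : {set {set V}}) (c : chain F V) (s t : {set V}) (u v : V).

Lemma elem_chainE s t : elem_chain F s t = (t == s)%:R.
Proof. by rewrite ffunE. Qed.

Lemma chain_sumE (Q : pred {set V}) c : (forall s, c s != 0 -> Q s) ->
  c = \sum_(s | Q s) c s *: elem_chain F s.
Proof.
move=> cP; apply/ffunP => t; rewrite sum_ffunE.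
under eq_bigr => s _ do rewrite ffunE elem_chainE.
have [tQ|tQ] := boolP (Q t).
  rewrite (bigD1 t) //= eqxx [_ *: _]mulr1 big1 ?addr0 // => s /andP[_ st].
  by rewrite eq_sym (negbTE st) scaler0.
rewrite big1 => [|s sQ]; first by apply/eqP; apply: contraNT tQ; exact: cP.
by case: eqP sQ => [<-|_ _]; [rewrite (negbTE tQ)|rewrite scaler0].
Qed.

Lemma mem_chainsP n L c :
  reflect (forall s, c s != 0 -> (s \in L) && (#|s| == n.+1)) (c \in chains F n L).
Proof.
apply: (iffP idP) => [/memv_sumP[w wP ->] s|/chain_sumE ->].
  apply: contraNT => sL; rewrite sum_ffunE big1 // => t tL.
  have /vlineP[k ->] := wP t tL.
  rewrite ffunE elem_chainE; case: eqP => [st|_]; last by rewrite scaler0.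
  by move: sL; rewrite st tL.
by apply: memv_sumr => s _; rewrite memvZ ?memv_line.
Qed.

Lemma boundaryE c t : boundary F V c t = if t == finset.set0 then 0 else
  \sum_(v | v \notin t) incidence F v t * c (v |: t).
Proof. by rewrite lfunE /= ffunE. Qed.

(** The sign rule behind both the vanishing of the double boundary and the
    cancellation of the walls of the strip. *)
Lemma incidence_setU1 u v t : v \notin t ->
  incidence F u (v |: t) =
    if (enum_rank v < enum_rank u)%N then - incidence F u t else incidence F u t.
Proof.
move=> vt; rewrite /incidence.
have -> : #|[pred w in v |: t | (enum_rank w < enum_rank u)%N]| =
    ((enum_rank v < enum_rank u)%N +
      #|[pred w in t | (enum_rank w < enum_rank u)%N]|)%N.
  rewrite [LHS](cardD1 v) !inE eqxx /=; congr (_ + _)%N.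
  apply: eq_card => w; rewrite !inE.
  by have [->|//] := eqVneq w v; rewrite (negbTE vt).
by case: ifP => _; rewrite ?add0n // add1n exprS mulN1r.
Qed.

(** Adding u then v to t gives the opposite of adding v then u.  The pairs are
    split according to the order of u and v, since a sum equal to its opposite
    need not vanish in characteristic 2. *)
Lemma boundary_boundary c : boundary F V (boundary F V c) = 0.
Proof.
apply/ffunP => t; rewrite boundaryE [RHS]ffunE; case: eqP => // /eqP t0.
pose G v u := incidence F v t * (incidence F u (v |: t) * c (u |: (v |: t))).
transitivity (\sum_(v | v \notin t) \sum_(u | (u \notin t) && (u != v)) G v u).
  apply: eq_bigr => v vt; rewrite boundaryE.
  have /negbTE -> : v |: t != finset.set0.
    by apply/finset.set0Pn; exists v; rewrite !inE eqxx.
  by rewrite mulr_sumr; apply: eq_bigl => u; rewrite !inE negb_or andbC.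
pose lt v u := (enum_rank v < enum_rank u)%N.
transitivity (\sum_(v | v \notin t)
    \sum_(u | (u \notin t) && lt v u) (G v u + G u v)).
  under [RHS]eq_bigr do rewrite big_split /=.
  rewrite big_split /=.
  rewrite [X in _ = _ + X](exchange_big_dep (fun u => u \notin t)) /=; last first.
    by move=> ? ? _ /andP[].
  rewrite -big_split /=; apply: eq_bigr => v vt.
  rewrite (bigID (lt v)) /=; congr (_ + _); apply: eq_bigl => u.
    rewrite -andbA; congr (_ && _); rewrite /lt.
    case: ltngtP => [vu||/ord_inj/enum_rank_inj->]; rewrite ?andbF ?eqxx // andbT.
    by apply: contraTneq vu => ->; rewrite ltnn.
  rewrite -andbA vt andTb; congr (_ && _); rewrite /lt.
  case: ltngtP => [||/ord_inj/enum_rank_inj->]; rewrite ?andbF ?eqxx // andbT.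
  by move=> uv; apply: contraTneq uv => ->; rewrite ltnn.
apply: big1 => v vt; apply: big1 => u /andP[ut vu]; rewrite /G.
rewrite !incidence_setU1 // -/(lt v u) vu /lt ltnNge ltnW //=.
rewrite finset.setUCA; ring.
Qed.

Lemma boundary_sub_cycles n L : simplicial_complex L ->
  (boundaries F n L <= cycles F n L)%VS.
Proof.
move=> [_ Lface]; apply/subvP => _ /memv_imgP[c /mem_chainsP cL ->].
rewrite memv_cap memv_ker boundary_boundary eqxx andbT.
apply/mem_chainsP => t; rewrite boundaryE.
have [_|t0] := eqVneq t finset.set0; rewrite ?eqxx //.
move=> sum0.
have /existsP[v /andP[vt cv]] : [exists v, (v \notin t) && (c (v |: t) != 0)].
  apply: contraNT sum0 => /existsPn nv; rewrite big1 // => v vt.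
  by have := nv v; rewrite vt negbK => /eqP ->; rewrite mulr0.
have /andP[vL] := cL _ cv; rewrite cardsU1 vt eqSS => ->; rewrite andbT.
by apply: Lface vL _ t0; exact: finset.subsetUr.
Qed.

End ChainComplex.

Lemma dim_lpreim_vsval (F : fieldType) (vT : vectType F) (Z B : {vspace vT}) :
  (B <= Z)%VS -> \dim (linfun (vsval : subvs_of Z -> vT) @^-1: B)%VS = \dim B.
Proof.
move=> BZ; set f := linfun _.
have fE w : f w = vsval w by rewrite lfunE.
rewrite -(limg_dim_eq (f := f)).
  rewrite lpreimK //; apply/subvP => v /(subvP BZ) Zv.
  by apply/memv_imgP; exists (vsproj Z v); rewrite ?memvf // fE vsprojK.
apply/eqP; rewrite -subv0; apply/subvP => w; rewrite memv_cap => /andP[_].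
by rewrite memv_ker fE memv0 -(inj_eq (@subvs_inj _ _ Z)) linear0.
Qed.

Section HomologyRank.
Context (F : fieldType) (R : realType) (d : nat) (V : finType).
Context (X : filtration R d V) (n : nat).

Definition union_complex (I : set (d.-tupleprod R)) : {set {set V}} :=
  [set t | `[< exists2 p, I p & t \in X p >]].

Lemma homology_rk_eq0 (I : Int (d.-tupleprod R)) p :
  val I p -> X p = finset.set0 -> rk (homology_module F n X) I = 0%N.
Proof.
move=> Ip Xp; apply: lin_rank0 => x.
apply: etrans (psi_indep _ (exist _ p (mem_set Ip)) x) _.
have H0 (z : homology F n (X p)) : z = 0.
  have [y <-] := vpi_surj z; suff -> : y = 0 by exact: linear0.
  apply: subvs_inj; transitivity (0 : chain F V); last by rewrite linear0.
  have := subvsP y; rewrite memv_cap => /andP[/mem_chainsP yX _].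
  apply/ffunP => t; rewrite [RHS]ffunE; apply/eqP.
  by apply: contraTT isT => /yX; rewrite Xp inE.
by rewrite /psi /colim_inj [lim_proj _ x]H0 !linear0.
Qed.

(** If the cycles do not change along I, the homology is a quotient of a
    constant module there, and the relations are the boundaries that occur
    somewhere on I. *)
Lemma homology_rk (I : Int (d.-tupleprod R)) (Z : {vspace chain F V}) :
    (forall p, val I p -> cycles F n (X p) = Z) ->
  rk (homology_module F n X) I =
    (\dim Z - \dim (boundaries F n (union_complex (val I))))%N.
Proof.
move=> cycZ; set L := union_complex _.
pose Q := set_type (val I).
have IQ (p : Q) : val I (val p) by exact: set_mem (valP p).
pose Xq (p : Q) := X (val p).
have cycQ (p : Q) : cycles F n (Xq p) = Z by exact: cycZ.
have BZ p : (boundaries F n (Xq p) <= Z)%VS.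
  by rewrite -(cycQ p); apply: boundary_sub_cycles; exact: fil_at_complex.
pose qf (p : Q) : subvs_of Z -> homology F n (Xq p) :=
  vpi (boundaries F n (Xq p)) \o vsproj (cycles F n (Xq p)) \o vsval.
pose q (p : Q) : 'Hom(subvs_of Z, homology F n (Xq p)) := linfun (qf p).
have qE p w : q p w = vpi (boundaries F n (Xq p)) (vsproj _ (vsval w)).
  by rewrite lfunE.
have q_ker p w : (w \in lker (q p)) = (vsval w \in boundaries F n (Xq p)).
  rewrite memv_ker qE -(linear0 (vpi (boundaries F n (Xq p)))).
  apply/eqP/idP => [/vpi_eq|wB].
    by rewrite linear0 addr0 vsprojK // cycQ subvsP.
  by apply/vpi_eq; rewrite linear0 addr0 vsprojK // cycQ subvsP.
(* Every simplex of the union is realized at some point of I; these finitely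
   many points suffice to generate all the boundaries. *)
have cover t : exists p : Q, t \in L -> t \in Xq p.
  have [|tL] := boolP (t \in L); last by exists (Int_point I).
  rewrite inE => /asboolP[p Ip tp].
  by exists (exist _ p (mem_set Ip)).
have {cover} [pt ptP] := choice cover.
have elemB t : t \in L -> #|t| == n.+2 ->
    boundary F V (elem_chain F t) \in boundaries F n (Xq (pt t)).
  move=> tL tn; apply: memv_img; apply/mem_chainsP => s.
  by rewrite elem_chainE; case: (s =P t) => [->|]; rewrite ?eqxx // ptP // tn.
have chainE c : c \in chains F n.+1 L ->
    c = \sum_(t in L | #|t| == n.+2) c t *: elem_chain F t.
  by move=> /mem_chainsP; exact: chain_sumE.
have BL : (boundaries F n L <= Z)%VS.
  apply/subvP => _ /memv_imgP[c /chainE -> ->].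
  rewrite linear_sum; apply: memv_suml => t /andP[tL tn].
  by rewrite linearZ memvZ //; apply: (subvP (BZ (pt t))); exact: elemB.
have -> : \dim Z = \dim {:subvs_of Z} by rewrite dimvf.
rewrite -(dim_lpreim_vsval BL).
pose M := pm_restrict (homology_module F n X) (val I).
apply: (@gen_rank_quotient F _ Q M (subvs_of Z) q _ _ _ _ _ [seq pt t | t in L]).
- move=> p r pr w; rewrite !qE.
  have pr' : Xq p \subset Xq r by apply: fil_mono.
  rewrite [LHS]vquot_mapE ?cyclesS ?boundariesS //.
  by rewrite vsprojK // cycQ subvsP.
- move=> p v; have [z <-] := vpi_surj v; exists (vsproj Z (vsval z)).
  by rewrite qE vsprojK -?(cycQ p) ?subvsP // vsvalK.
- move=> p; apply/subvP => w; rewrite q_ker -memv_preim lfunE /=.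
  apply/subvP/boundariesS/fintype.subsetP => t tp; rewrite inE.
  by apply/asboolP; exists (val p).
- by move=> p r; exact: psi_indep.
apply/subvP => w; rewrite -memv_preim lfunE /= => /memv_imgP[c /chainE cE wE].
have -> : w = \sum_(t in L | #|t| == n.+2)
    (c t : F) *: vsproj Z (boundary F V (elem_chain F t)).
  apply: subvs_inj; rewrite wE {1}cE !linear_sum; apply: eq_bigr => t /andP[tL tn].
  by rewrite !linearZ /= vsprojK // (subvP (BZ (pt t))) ?elemB.
rewrite big_map big_enum /=.
apply: memv_suml => t /andP[tL tn]; apply: memvZ.
apply: (subvP (sumv_sup t tL (subvv _))).
by rewrite q_ker vsprojK ?elemB // (subvP (BZ (pt t))) ?elemB.
Qed.

End HomologyRank.

Local Close Scope classical_set_scope.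

(** * The strip complex *)

(** The vertices are 0, ..., n along the strip, then n+1, ..., n+m which belong to
    all the faces, and the apex n+m+1.  The order of the vertices is what orients
    the simplices: with those along the strip first, consecutive cells induce
    opposite orientations on the wall between them. *)
Section Strip.
Context (n m : nat).
Notation V := 'I_(n + m).+2.

(** strip_face j is the common face of the facets j-1 and j; adding the apex to a
    face or to a facet gives a wall or a cell.  The indices are natural numbers,
    so that both ends of the strip can be treated alike. *)
Definition strip_face (j : nat) : {set V} :=
  [set w : V | (w == j :> nat) || (n < w <= n + m)%N].
Definition strip_facet (i : nat) : {set V} :=
  [set w : V | [|| w == i :> nat, w == i.+1 :> nat | (n < w <= n + m)%N]].
Definition strip_wall (j : nat) : {set V} :=
  [set w : V | (w == j :> nat) || (n < w)%N].
Definition strip_cell (i : nat) : {set V} :=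
  [set w : V | [|| w == i :> nat, w == i.+1 :> nat | (n < w)%N]].

(** The largest complex of dimension m+1 in which an interior face has only the
    two neighbouring facets as cofaces.  Being so large, it contains all the
    facets of the cells except the interior walls. *)
Definition strip_complex : {set {set V}} :=
  [set s : {set V} | [&& s != finset.set0, (#|s| <= m.+2)%N &
    [forall j : 'I_n, (0 < j)%N ==> (strip_face j \subset s) ==>
      [|| s == strip_face j, s == strip_facet j.-1 | s == strip_facet j]]]].

(** Facets have top dimension, so that any set of them can be removed;
    this leaves the m-simplices, hence the m-cycles, unchanged. *)
Definition strip_subcomplex (S : {set 'I_n}) : {set {set V}} :=
  [set s in strip_complex | [forall i : 'I_n, (s == strip_facet i) ==> (i \in S)]].

Lemma inord_stripE k : (k <= n)%N -> (inord k : V) = k :> nat.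
Proof. by move=> kn; rewrite inordK //; lia. Qed.

Lemma strip_complexP (s : {set V}) :
  reflect [/\ s != finset.set0, (#|s| <= m.+2)%N &
    forall j, (0 < j < n)%N -> strip_face j \subset s ->
      [\/ s = strip_face j, s = strip_facet j.-1 | s = strip_facet j]]
    (s \in strip_complex).
Proof.
rewrite inE; apply: (iffP and3P) => -[s0 sm sP]; split=> //.
  move=> j /andP[j0 jn] js.
  have /forallP/(_ (Ordinal jn)) := sP; rewrite /= j0 js /=.
  by case/or3P => /eqP; [constructor 1|constructor 2|constructor 3].
apply/forallP => j; apply/implyP => j0; apply/implyP => js.
by case: (sP j _ js) => [|->|->|->]; rewrite ?j0 ?ltn_ord ?eqxx ?orbT.
Qed.

Lemma card_strip_face j : (j <= n)%N -> #|strip_face j| = m.+1.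
Proof.
move=> lejn; pose f (k : 'I_m) : V := inord (n.+1 + k).
have fE k : f k = (n.+1 + k)%N :> nat by rewrite inordK //; have := ltn_ord k; lia.
have f_inj : injective f.
  by move=> k l /(congr1 (@nat_of_ord _)); rewrite !fE => /addnI/ord_inj.
have -> : strip_face j = inord j |: [set f k | k in 'I_m].
  apply/setP => w; rewrite !inE -val_eqE /= inordK; last by lia.
  congr (_ || _); apply/idP/imsetP => [wn|[k _ ->]].
    have km : (w - n.+1 < m)%N by lia.
    by exists (Ordinal km) => //; apply: ord_inj; rewrite fE /=; lia.
  by rewrite fE; have := ltn_ord k; lia.
rewrite cardsU1 card_imset // card_ord; case: imsetP => // -[k _].
by move=> /(congr1 (@nat_of_ord _)); rewrite fE /= inordK; lia.
Qed.

Lemma strip_facet_setU1 i : (i < n)%N -> strip_facet i = inord i |: strip_face i.+1.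
Proof.
move=> ltin; apply/setP => w; rewrite !inE -val_eqE /= inordK; last by lia.
by rewrite orbA.
Qed.

Lemma strip_facet_setU1r i : (i < n)%N -> strip_facet i = inord i.+1 |: strip_face i.
Proof.
move=> ltin; apply/setP => w; rewrite !inE -val_eqE /= inordK; last by lia.
by rewrite orbCA.
Qed.

Lemma strip_cell_setU1 i : strip_cell i = ord_max |: strip_facet i.
Proof.
apply/setP => w; rewrite !inE -val_eqE /=; have := ltn_ord w.
move=> wlt; apply/idP/idP; lia.
Qed.

Lemma card_strip_facet i : (i < n)%N -> #|strip_facet i| = m.+2.
Proof.
move=> ltin; rewrite strip_facet_setU1 // cardsU1 card_strip_face //.
by rewrite inE inordK /=; lia.
Qed.

Lemma card_strip_cell i : (i < n)%N -> #|strip_cell i| = m.+3.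
Proof.
move=> ltin; rewrite strip_cell_setU1 cardsU1 card_strip_facet //.
by rewrite inE /=; lia.
Qed.

Lemma strip_facet_inj i k : (i < n)%N -> strip_facet i = strip_facet k -> i = k.
Proof.
move=> ltin ik.
have i1 : inord i \in strip_facet k by rewrite -ik inE inordK ?eqxx //; lia.
have i2 : inord i.+1 \in strip_facet k by rewrite -ik inE inordK ?eqxx ?orbT //; lia.
by move: i1 i2; rewrite !inE !inordK; lia.
Qed.

Lemma strip_facet_in i : (i < n)%N -> strip_facet i \in strip_complex.
Proof.
move=> ltin; apply/strip_complexP; split.
- by rewrite -card_gt0 card_strip_facet.
- by rewrite card_strip_facet.
- move=> j /andP[j0 jn] /fintype.subsetP/(_ (inord j)).
  rewrite !inE inordK ?eqxx; last by lia.
  move=> /(_ isT) ji; have [->|->] : i = j \/ i = j.-1 by lia.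
    by constructor 3.
  by constructor 2.
Qed.

Lemma strip_complex_simplicial : simplicial_complex strip_complex.
Proof.
split; first by apply/negP => /strip_complexP[]; rewrite eqxx.
move=> s t /strip_complexP[s0 sm sP] ts t0; apply/strip_complexP; split=> //.
  exact: leq_trans (subset_leq_card ts) sm.
move=> j jn jt; have js := fintype.subset_trans jt ts.
have mid v (u : {set V}) : s = v |: u -> u \subset t -> t = u \/ t = s.
  move=> suv ut; have [vt|vt] := boolP (v \in t); [right|left].
    by apply/eqP; rewrite finset.eqEsubset ts suv finset.subUset finset.sub1set vt.
  apply/eqP; rewrite finset.eqEsubset ut andbT; apply/fintype.subsetP => w wt.
  have := fintype.subsetP ts w wt; rewrite suv !inE => /orP[/eqP wv|//].
  by rewrite -wv wt in vt.
have [sE|sE|sE] := sP j jn js.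
- by constructor 1; apply/eqP; rewrite finset.eqEsubset jt andbT -sE.
- have [||->|->] := mid (inord j.-1) (strip_face j) => //.
  + by rewrite sE strip_facet_setU1 ?prednK //; lia.
  + by constructor 1.
  + by constructor 2.
- have [||->|->] := mid (inord j.+1) (strip_face j) => //.
  + by rewrite sE strip_facet_setU1r //; lia.
  + by constructor 1.
  + by constructor 3.
Qed.

Lemma strip_subcomplex_simplicial S : simplicial_complex (strip_subcomplex S).
Proof.
have [K0 Kface] := strip_complex_simplicial.
split; first by rewrite inE (negbTE K0).
move=> s t; rewrite inE => /andP[sK /forallP sS] ts t0.
rewrite inE (Kface _ _ sK ts t0); apply/forallP => i; apply/implyP => /eqP ti.
apply: implyP (sS i) _; rewrite eq_sym -ti finset.eqEcard ts ti card_strip_facet //.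
by have /strip_complexP[] := sK.
Qed.

Lemma mem_strip_subcomplex_facet S (i : 'I_n) :
  (strip_facet i \in strip_subcomplex S) = (i \in S).
Proof.
rewrite inE strip_facet_in //=; apply/forallP/idP => [/(_ i)|iS k].
  by rewrite eqxx.
by apply/implyP => /eqP/(strip_facet_inj (ltn_ord i))/ord_inj <-.
Qed.

Lemma strip_subcomplexS (S S' : {set 'I_n}) : S \subset S' ->
  strip_subcomplex S \subset strip_subcomplex S'.
Proof.
move=> SS'; apply/fintype.subsetP => s; rewrite !inE => /andP[-> /forallP sS].
apply/forallP => i; apply/implyP => si; apply: (fintype.subsetP SS').
exact: implyP (sS i) si.
Qed.

Lemma strip_subcomplexT : strip_subcomplex [set: 'I_n] = strip_complex.
Proof.
apply/setP => s; rewrite inE andb_idr // => _.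
by apply/forallP => i; rewrite inE implybT.
Qed.

Lemma strip_subcomplexU1 (S : {set 'I_n}) (i : 'I_n) :
  strip_subcomplex (i |: S) = strip_facet i |: strip_subcomplex S.
Proof.
apply/setP => s; rewrite in_setU1; have [->|si] /= := eqVneq s (strip_facet i).
  by rewrite mem_strip_subcomplex_facet setU11.
rewrite !inE; congr (_ && _); apply: eq_forallb => k; rewrite !inE.
by case: eqP => //= sk; have [ki|//] := eqVneq k i; rewrite sk ki eqxx in si.
Qed.

End Strip.

(** * Boundaries in the strip complex *)

Section StripHomology.
Context (F : fieldType) (n m : nat).
Notation V := 'I_(n + m).+2.
Notation tau := (strip_facet n m).
Notation phi := (strip_face n m).
Notation rho := (strip_wall n m).
Notation gam := (strip_cell n m).
Notation K := (strip_complex n m).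
Notation KS := (@strip_subcomplex n m).

Lemma incidence_neq0 (v : V) t : incidence F v t != 0.
Proof. by rewrite signr_eq0. Qed.

(** The boundary of z at the face j only receives contributions from the
    facets j-1 and j. *)
Lemma strip_cycle_facet (z : chain F V) j : (0 < j < n)%N ->
    z \in chains F m.+1 K -> boundary F V z = 0 ->
  (z (tau j.-1) == 0) = (z (tau j) == 0).
Proof.
move=> /andP[j0 jn] /mem_chainsP zK /ffunP/(_ (phi j)).
have jV := @inord_stripE n m.
rewrite boundaryE [RHS]ffunE ifF; last first.
  by apply/negbTE; rewrite -card_gt0 card_strip_face // ltnW.
have jp : (inord j.-1 : V) \notin phi j by rewrite inE jV; lia.
have jq : (inord j.+1 : V) \notin phi j by rewrite inE jV; lia.
rewrite (bigD1 (inord j.-1)) //= (bigD1 (inord j.+1)) /=; last first.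
  by rewrite jq -val_eqE /= !jV; lia.
have tp : inord j.-1 |: phi j = tau j.-1.
  by rewrite strip_facet_setU1 ?prednK //; lia.
rewrite tp -strip_facet_setU1r // big1 => [|v /andP[/andP[vj vp] vq]]; last first.
  have [-> //|] := eqVneq (z (v |: phi j)) 0; first by rewrite mulr0.
  move=> /zK/andP[/strip_complexP[_ _ KP] _].
  have vE := KP j (introT andP (conj j0 jn)) (finset.subsetUr _ _).
  have vin : v \in v |: phi j by rewrite setU11.
  exfalso; case: vE => vE; rewrite vE in vin.
  - by rewrite vin in vj.
  - by move: vin vj vp; rewrite -tp in_setU1 => /orP[->|->].
  - by move: vin vj vq; rewrite strip_facet_setU1r // in_setU1 => /orP[->|->].
rewrite addr0 => /eqP; have [-> | zp] := eqVneq (z (tau j.-1)) 0.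
  by rewrite mulr0 add0r mulf_eq0 (negbTE (incidence_neq0 _ _)) => /= ->.
have [-> | //] := eqVneq (z (tau j)) 0.
by rewrite mulr0 addr0 mulf_eq0 (negbTE (incidence_neq0 _ _)) (negbTE zp).
Qed.

Lemma strip_cycle_eq0 (z : chain F V) i k : (i < n)%N -> (k < n)%N ->
    z \in chains F m.+1 K -> boundary F V z = 0 ->
  z (tau i) = 0 -> z (tau k) = 0.
Proof.
move=> ltin ltkn zK z0.
have z0E l : (l < n)%N -> (z (tau l) == 0) = (z (tau 0) == 0).
  elim: l => // l IH ltln; rewrite -IH ?(ltnW ltln) //.
  by rewrite -(@strip_cycle_facet z l.+1).
by move=> /eqP; rewrite z0E // -(z0E k) // => /eqP.
Qed.

(** The sum of all the cells of the fan, with the same sign. *)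
Definition strip_chain : chain F V := [ffun s => [exists i : 'I_n, s == gam i]%:R].

Definition strip_sphere : chain F V := boundary F V strip_chain.

Lemma strip_sphere_facet (i : 'I_n) : strip_sphere (tau i) != 0.
Proof.
rewrite boundaryE ifF; last by apply/negbTE; rewrite -card_gt0 card_strip_facet.
have mi : ord_max \notin tau i by rewrite inE /=; have := ltn_ord i; lia.
rewrite (bigD1 ord_max) //= big1 => [|v /andP[vi vmax]].
  rewrite addr0 -strip_cell_setU1 ffunE.
  by rewrite (introT existsP) ?mulr1 ?incidence_neq0 //; exists i.
rewrite ffunE; case: existsP => [[k /eqP vE]|]; last by rewrite mulr0.
have : ord_max \in v |: tau i by rewrite vE strip_cell_setU1 setU11.
by rewrite in_setU1 (negbTE mi) orbF eq_sym (negbTE vmax).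
Qed.

(** The two cells around an interior wall differ from it by the vertices j-1 and
    j+1, which have opposite incidence since exactly one vertex of the wall,
    namely j, lies between them. *)
Lemma strip_sphere_wall j : (0 < j < n)%N -> strip_sphere (rho j) = 0.
Proof.
move=> /andP[j0 jn]; rewrite boundaryE; case: ifP => // _.
have jV := @inord_stripE n m.
have jp : (inord j.-1 : V) \notin rho j by rewrite inE jV; lia.
have jq : (inord j.+1 : V) \notin rho j by rewrite inE jV; lia.
have cp : inord j.-1 |: rho j = gam j.-1.
  by apply/setP => w; rewrite !inE -val_eqE /= jV ?prednK //; lia.
have cq : inord j.+1 |: rho j = gam j.
  by apply/setP => w; rewrite !inE -val_eqE /= jV //; lia.
have cell1 k : (k < n)%N -> strip_chain (gam k) = 1.
  by move=> kn; rewrite ffunE (introT existsP) //; exists (Ordinal kn).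
rewrite (bigD1 (inord j.-1)) //= (bigD1 (inord j.+1)) /=; last first.
  by rewrite jq -val_eqE /= !jV; lia.
rewrite cp cq !cell1 ?mulr1; [|lia|lia].
rewrite big1 => [|v /andP[/andP[vj vp] vq]]; last first.
  rewrite ffunE; case: existsP => [[k /eqP vE]|]; last by rewrite mulr0.
  exfalso; have vk : v \in gam k by rewrite -vE setU11.
  have : (inord j : V) \in gam k by rewrite -vE !inE jV ?eqxx ?orbT // ltnW.
  move: vj vp vq vk; rewrite !inE -!val_eqE /= !jV; [|lia|lia|lia].
  lia.
pose j' : V := inord j.
have -> : rho j = j' |: (rho j :\ j').
  by rewrite finset.setD1K // inE jV ?eqxx // ltnW.
rewrite !incidence_setU1 ?setD11 // !enum_rank_ord /= !jV; [|lia|lia|lia].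
rewrite ifF ?ifT; [|lia|lia].
have -> : incidence F (inord j.-1) (rho j :\ j') =
    incidence F (inord j.+1) (rho j :\ j').
  congr (_ ^+ _); apply: eq_card => w.
  rewrite !inE -!val_eqE /= !enum_rank_ord /= !jV; [|lia|lia|lia].
  by apply/idP/idP; lia.
by rewrite addr0 subrr.
Qed.

(** A simplex of dimension m+1 outside the complex contains an interior face; if
    it is moreover a facet of a cell, it must be an interior wall. *)
Lemma strip_sphere_chain : strip_sphere \in chains F m.+1 K.
Proof.
apply/mem_chainsP => t tw.
have t0 : t != finset.set0.
  by apply: contraNneq tw => ->; rewrite boundaryE eqxx.
have [v vt [i vE]] : exists2 v, v \notin t & exists i : 'I_n, v |: t = gam i.
  move: tw; rewrite boundaryE (negbTE t0) => tw.
  have /existsP[v /andP[vt /existsP[i /eqP vE]]] :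
      [exists v, (v \notin t) && [exists i : 'I_n, v |: t == gam i]].
    apply: contraNT tw => /existsPn nv; rewrite big1 // => v vt.
    by have := nv v; rewrite vt ffunE /= => /negbTE ->; rewrite mulr0.
  by exists v => //; exists i.
have ct : #|t| = m.+2.
  by have := card_strip_cell m (ltn_ord i); rewrite -vE cardsU1 vt => -[].
rewrite ct eqxx andbT; apply/strip_complexP; split; rewrite ?ct //.
move=> j /andP[j0 jn] jt.
have ltin := ltn_ord i.
have jV := @inord_stripE n m.
have tE : t = gam i :\ v by rewrite -vE finset.setU1K.
have jin : (inord j : V) \in t.
  by apply: (fintype.subsetP jt); rewrite inE jV ?eqxx // ltnW.
have ji : i = j :> nat \/ i = j.-1 :> nat.
  by move: jin; rewrite tE !inE jV; lia.
have [vmax|vmax] := eqVneq v ord_max.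
  have ti : t = tau i.
    rewrite tE vmax strip_cell_setU1 finset.setU1K // inE /=; lia.
  by case: ji ti => ->; [constructor 3|constructor 2].
suff tr : t = rho j by rewrite tr strip_sphere_wall ?eqxx ?j0 // in tw.
have vj : v \notin phi j by apply: contraNN vt => /(fintype.subsetP jt).
have vi : v \in gam i by rewrite -vE setU11.
rewrite tE; apply/setP => w; move: vj vi vmax; rewrite !inE -!val_eqE /=.
have := ltn_ord v; have := ltn_ord w.
move=> wlt vlt vj vi vmax; apply/idP/idP; lia.
Qed.

Lemma chainsU1 k (L : {set {set V}}) s : s \notin L -> #|s| = k.+1 ->
  chains F k (s |: L) = (<[elem_chain F s]> + chains F k L)%VS.
Proof.
move=> sL sk; rewrite /chains !big_mkcondr (big_setU1 _ sL) /=.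
by rewrite sk eqxx.
Qed.

Lemma boundaries_strip_U1 (S : {set 'I_n}) (i : 'I_n) : i \notin S ->
  boundaries F m (KS (i |: S)) =
    (<[boundary F V (elem_chain F (tau i))]> + boundaries F m (KS S))%VS.
Proof.
move=> iS; rewrite /boundaries strip_subcomplexU1 chainsU1 ?card_strip_facet //.
  by rewrite limgD limg_line.
by rewrite mem_strip_subcomplex_facet.
Qed.

(** If the boundary of the facet i were a boundary already, there would be a cycle
    through the facet i that misses the facet k. *)
Lemma boundary_facet_free (S : {set 'I_n}) (i k : 'I_n) :
    i \notin S -> k \notin i |: S ->
  boundary F V (elem_chain F (tau i)) \notin boundaries F m (KS S).
Proof.
move=> iS kS; apply/negP => /memv_imgP[c cS ic].
pose z := elem_chain F (tau i) - c.
have inK (c' : chain F V) (S' : {set 'I_n}) :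
    c' \in chains F m.+1 (KS S') -> c' \in chains F m.+1 K.
  apply/subvP/chainsS; rewrite -strip_subcomplexT.
  exact/strip_subcomplexS/finset.subsetT.
have iK : elem_chain F (tau i) \in chains F m.+1 K.
  apply/mem_chainsP => s; rewrite elem_chainE; case: (s =P tau i) => [->|_].
    by rewrite strip_facet_in ?card_strip_facet ?eqxx.
  by rewrite eqxx.
have c0 (l : 'I_n) : l \notin S -> c (tau l) = 0.
  move=> lS; apply/eqP; apply: contraNT lS => /(mem_chainsP _ _ _ cS)/andP[].
  by rewrite mem_strip_subcomplex_facet.
have zK : z \in chains F m.+1 K by rewrite memvB // (inK _ S).
have dz : boundary F V z = 0 by rewrite linearB /= ic subrr.
have zk : z (tau k) = 0.
  rewrite !ffunE c0; last by move: kS; rewrite !inE negb_or => /andP[].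
  case: eqP => [/(strip_facet_inj (ltn_ord k))/ord_inj ki|_]; last by rewrite subr0.
  by rewrite ki setU11 in kS.
have := strip_cycle_eq0 (ltn_ord k) (ltn_ord i) zK dz zk.
by rewrite !ffunE c0 // eqxx subr0 => /eqP; rewrite oner_eq0.
Qed.

(** The sphere, rescaled, expresses the boundary of any facet by those of the
    others. *)
Lemma boundary_facet_dependent (i : 'I_n) :
  boundary F V (elem_chain F (tau i)) \in boundaries F m (KS [set~ i]).
Proof.
pose a := strip_sphere (tau i).
pose c := elem_chain F (tau i) - (a^-1 : F) *: strip_sphere.
have wi : boundary F V (elem_chain F (tau i)) = boundary F V c.
  by rewrite linearB linearZ /= boundary_boundary scaler0 subr0.
rewrite wi; apply: memv_img; apply/mem_chainsP => t.
rewrite !ffunE; have [->|ti] := eqVneq t (tau i).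
  by rewrite [_ *: _]mulVf ?strip_sphere_facet // subrr eqxx.
rewrite sub0r oppr_eq0 scaler_eq0 negb_or => /andP[_ wt].
have /andP[tK ->] := mem_chainsP _ _ _ strip_sphere_chain _ wt; rewrite andbT.
rewrite inE tK; apply/forallP => k; apply/implyP => /eqP tk.
by rewrite !inE; apply: contraNneq ti => <-; rewrite tk.
Qed.

(** The facets form a circuit: each one raises the dimension by 1, except the
    last. *)
Lemma dim_boundaries_strip (S : {set 'I_n}) : (0 < n)%N ->
  (\dim (boundaries F m (KS S)) + (S == [set: 'I_n]))%N =
    (\dim (boundaries F m (KS finset.set0)) + #|S|)%N.
Proof.
move=> n_gt0.
have free S' : S' != [set: 'I_n] ->
    \dim (boundaries F m (KS S')) =
      (\dim (boundaries F m (KS finset.set0)) + #|S'|)%N.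
  have [k] := ubnP #|S'|; elim: k S' => // k IH S'.
  have [->|/finset.set0Pn[i iS']] := eqVneq S' finset.set0.
    by rewrite finset.cards0 addn0.
  rewrite -(finset.setD1K iS'); set S0 := S' :\ i => cardS S'T.
  have iS0 : i \notin S0 by rewrite setD11.
  have /existsP[l lS] : [exists l, l \notin i |: S0].
    apply: contraNT S'T => /existsPn nl; apply/eqP/setP => l; rewrite [RHS]inE.
    by have := nl l; rewrite negbK.
  rewrite boundaries_strip_U1 // cardsU1 iS0.
  rewrite dimv_disjoint_sum; last first.
    apply/eqP; rewrite -subv0; apply/subvP => v.
    rewrite memv_cap => /andP[/vlineP[a ->]].
    have [->|a0] := eqVneq a 0; first by rewrite scale0r => _; exact: mem0v.
    move=> /(memvZ a^-1); rewrite scalerA mulVf // scale1r.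
    by rewrite (negbTE (boundary_facet_free iS0 lS)).
  rewrite dim_vline.
  have -> : boundary F V (elem_chain F (tau i)) != 0.
    by apply: contraNneq (boundary_facet_free iS0 lS) => ->; exact: mem0v.
  rewrite IH; first by rewrite addnCA.
    by move: cardS; rewrite cardsU1 iS0.
  by apply: contraNneq lS => ->; rewrite !inE orbT.
have [->|ST] := eqVneq S [set: 'I_n]; last by rewrite addn0 free.
pose i : 'I_n := Ordinal n_gt0.
have iS : i \notin [set~ i] by rewrite !inE eqxx.
have -> : [set: 'I_n] = i |: [set~ i] by rewrite finset.setUCr.
rewrite boundaries_strip_U1 // cardsU1 iS (addv_idPr _).
  rewrite free; first by rewrite /= addn1 add1n addnS.
  by apply: contraNneq iS => ->; rewrite inE.
by rewrite -memvE; exact: boundary_facet_dependent.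
Qed.

Lemma cycles_strip (S : {set 'I_n}) : cycles F m (KS S) = cycles F m K.
Proof.
congr (_ :&: _)%VS; apply: eq_bigl => s; rewrite inE.
have [sm|] := eqVneq #|s| m.+1; last by rewrite !andbF.
rewrite !andbT andb_idr // => _; apply/forallP => i.
apply/implyP => /eqP sE; move: sm; rewrite sE card_strip_facet // => /eqP.
by rewrite eqn_leq ltnn.
Qed.

End StripHomology.

(** * Counting subsets *)

(** A nonempty set with at most k elements is the image of a map from a set with
    k elements. *)
Lemma card_small_sets (V : finType) (k : nat) (L : {set {set V}}) :
    (forall s, s \in L -> (s != finset.set0) && (#|s| <= k)%N) ->
  (#|L| <= #|V| ^ k)%N.
Proof.
move=> LP; pose f (g : {ffun 'I_k -> V}) : {set V} := [set g i | i in 'I_k]%SET.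
have /subset_leq_card : L \subset (f @: [set: {ffun 'I_k -> V}])%SET.
  apply/fintype.subsetP => s /LP /andP[/finset.set0Pn[x xs] sk].
  apply/imsetP; exists [ffun i : 'I_k => nth x (enum s) i]; first by rewrite inE.
  apply/setP => y; apply/idP/imsetP => [ys|[i _ ->]].
    have iy : (index y (enum s) < k)%N.
      by apply: leq_trans sk; rewrite cardE index_mem mem_enum.
    by exists (Ordinal iy) => //; rewrite ffunE nth_index ?mem_enum.
  rewrite ffunE; have [lti|gei] := ltnP i (size (enum s)).
    by rewrite -mem_enum mem_nth.
  by rewrite nth_default.
move/leq_trans; apply; apply: leq_trans (leq_imset_card _ _) _.
by rewrite cardsT card_ffun card_ord.
Qed.

(** Expand the product over all i of 1 - [i in A]. *)
Lemma sum_subset_sign (I : finType) (A : {set I}) :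
  \sum_(B : {set I} | B \subset A) (-1) ^+ #|B| = (A == finset.set0)%:R :> int.
Proof.
have := @bigA_distr int 0 1 *%R +%R I (fun i => - (i \in A)%:R) (fun=> 1).
rewrite (eq_bigr (fun i => (i \notin A)%:R)); last first.
  by move=> i _; case: (i \in A); rewrite ?addNr ?oppr0 ?add0r.
move=> prodE; rewrite big_mkcond /=; transitivity (\prod_i (i \notin A)%:R : int).
  rewrite prodE; apply: eq_bigr => B _; rewrite -big_mkcond /=.
  case: ifPn => [BA|/fintype.subsetPn[i iB iA]].
    rewrite (eq_bigr (fun=> -1)) ?prodr_const // => i iB.
    by rewrite (fintype.subsetP BA).
  by rewrite (bigD1 i) //= (negbTE iA) oppr0 mul0r.
have [->|/finset.set0Pn[i iA]] := eqVneq A finset.set0.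
  by rewrite big1 // => i _; rewrite inE.
by rewrite (bigD1 i) //= iA mul0r.
Qed.

Lemma card_sets_ge2 n : (2 ^ n - n.+1 <= #|[pred T : {set 'I_n} | (1 < #|T|)%N]|)%N.
Proof.
pose small : {set {set 'I_n}} := [set T : {set 'I_n} | (#|T| <= 1)%N]%SET.
have -> : #|[pred T : {set 'I_n} | (1 < #|T|)%N]| = #|(~: small)%SET|.
  by apply: eq_card => T; rewrite !inE -ltnNge.
have : (#|small| <= n.+1)%N.
  pose f (o : option 'I_n) := if o is Some i then [set i]%SET else finset.set0.
  have /subset_leq_card : small \subset (f @: [set: option 'I_n])%SET.
    apply/fintype.subsetP => T; rewrite inE leq_eqVlt ltnS leqn0 cards_eq0.
    case/orP => [/cards1P[i ->]|/eqP ->]; apply/imsetP.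
      by exists (Some i); rewrite ?inE.
    by exists None; rewrite ?inE.
  move/leq_trans; apply; apply: leq_trans (leq_imset_card _ _) _.
  by rewrite cardsT card_option card_ord.
have := cardsC small.
rewrite -[#|{set _}|]cardsT -powersetT card_powerset cardsT card_ord.
by lia.
Qed.

(** With n = 2 ^ t both sides are comparable with powers of 2, and the claim
    reduces to a linear function of t being smaller than 2 ^ t. *)
Lemma exp_beats_poly (c e m : nat) :
  exists2 n, (0 < n)%N & (c * (n + m).+2 ^ e + n.+1 < 2 ^ n)%N.
Proof.
have two k : (k < 2 ^ k)%N by exact: ltn_expl.
have [t t_big] : exists t, (c + t.+1 * e.+1 + m.+2 <= 2 ^ t)%N.
  (* With t = 2 * s, squaring s < 2 ^ s gives a quadratic lower bound, which
     beats the linear function of s once s exceeds the coefficients. *)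
  pose s := (2 * e + c + m + 3)%N; exists (2 * s)%N.
  have -> : (2 ^ (2 * s) = 2 ^ s * 2 ^ s)%N by rewrite -expnD mul2n addnn.
  apply: (@leq_trans (s.+1 * s.+1)); last by rewrite leq_mul ?two.
  have -> : (s.+1 * s.+1 = 2 * s.+1 * e.+1 + s.+1 * (c + m.+2))%N.
    by rewrite -mulnA [(2 * _)%N]mulnCA -mulnDr; congr muln; rewrite /s; lia.
  rewrite addnAC addnC leq_add ?leq_pmull //.
  by rewrite leq_mul2r mulnS ltnS leqnSn orbT.
have [n nE] : exists n, n = (2 ^ t)%N by exists (2 ^ t)%N.
rewrite -nE in t_big.
have nm : ((n + m).+2 <= 2 ^ t.+1)%N by rewrite expnS -nE; lia.
have n_gt0 : (0 < n)%N by lia.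
exists n => //.
have h1 : (c * (n + m).+2 ^ e <= 2 ^ (c + t.+1 * e))%N.
  rewrite expnD expnM leq_mul ?(ltnW (two c)) //.
  by have [->|e_gt0] := posnP e; rewrite ?expn0 // leq_exp2r.
have h2 : (n.+1 < 2 ^ t.+1)%N by rewrite expnS -nE; lia.
have h3 : (2 ^ (c + t.+1 * e) <= 2 ^ n.-1)%N by rewrite leq_exp2l //; lia.
have h4 : (2 ^ t.+1 <= 2 ^ n.-1)%N by rewrite leq_exp2l //; lia.
have -> : (2 ^ n = 2 ^ n.-1 + 2 ^ n.-1)%N.
  by rewrite addnn -mul2n -expnS prednK.
by have := leq_add h1 h2; have := leq_add h3 h4; lia.
Qed.

Local Open Scope classical_set_scope.

(** * The strip filtration *)

Section StripFiltration.
Context (F : fieldType) (R : realType) (d n m : nat).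
Notation P := (d.-tupleprod R).
Notation V := 'I_(n + m).+2.
Implicit Types (p q : P) (i : 'I_n) (T : {set 'I_n}).

Definition origin : P := [tuple 0 | k < d].
(** The points b i: an antichain in the first two coordinates.  The first one is
    positive, so that no stage lies below the origin. *)
Definition stage (i : nat) : P :=
  [tuple (if k == 0%N :> nat then i.+1%:R
          else if k == 1%N :> nat then (n - i)%:R else 0) | k < d].
(** A point above all the stages, where the whole complex is reached. *)
Definition top_corner : P := [tuple n.+1%:R | k < d].

Lemma tuple_leP p q : reflect (forall k, tnth p k <= tnth q k) (p <= q)%O.
Proof. by rewrite Order.TupleProdOrder.leEtprod; exact: forallP. Qed.

Lemma origin_le_stage i : (origin <= stage i)%O.
Proof.
by apply/tuple_leP => k; rewrite !tnth_mktuple; do 2?case: ifP => _; rewrite ?ler0n.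
Qed.

Lemma stage_le_top i : (stage i <= top_corner)%O.
Proof.
apply/tuple_leP => k; rewrite !tnth_mktuple; have := ltn_ord i.
by do 2?case: ifP => _; rewrite ?ler0n // ler_nat; lia.
Qed.

Lemma origin_le_top : (origin <= top_corner)%O.
Proof. by apply/tuple_leP => k; rewrite !tnth_mktuple ler0n. Qed.

Definition stages_below p : {set 'I_n} := [set i : 'I_n | (stage i <= p)%O]%SET.

Definition strip_at p : {set {set V}} :=
  if (origin <= p)%O then strip_subcomplex m (stages_below p) else finset.set0.

Fact strip_at_complex p : simplicial_complex (strip_at p).
Proof.
rewrite /strip_at; case: ifP => _; first exact: strip_subcomplex_simplicial.
by split => [|s t]; rewrite inE.
Qed.

Fact strip_at_sub p : strip_at p \subset strip_complex n m.
Proof.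
rewrite /strip_at; case: ifP => _; last exact: finset.sub0set.
by rewrite -strip_subcomplexT; exact/strip_subcomplexS/finset.subsetT.
Qed.

Fact strip_at_mono p q : (p <= q)%O -> strip_at p \subset strip_at q.
Proof.
move=> pq; rewrite /strip_at; case: ifP => op; last exact: finset.sub0set.
rewrite (le_trans op pq); apply: strip_subcomplexS; apply/fintype.subsetP => i.
by rewrite !inE => /le_trans; exact.
Qed.

Fact strip_at_exhaust : exists p, strip_at p = strip_complex n m.
Proof.
exists top_corner; rewrite /strip_at origin_le_top -strip_subcomplexT.
by congr (strip_subcomplex m); apply/setP => i; rewrite !inE stage_le_top.
Qed.

Definition strip_filtration : filtration R d V :=
  Filtration (strip_complex_simplicial n m) strip_at_complex strip_at_sub
    strip_at_mono strip_at_exhaust.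

Lemma strip_filtration_finite : finite_filtration strip_filtration.
Proof.
move=> s sK; have [/existsP[i /eqP si]|/existsPn si] :=
    boolP [exists i : 'I_n, s == strip_facet n m i].
  exists [:: stage i] => p; rewrite /= /strip_at; split.
    case: ifP => [_|]; last by rewrite inE.
    rewrite si mem_strip_subcomplex_facet inE => ip.
    by exists (stage i); rewrite ?mem_head.
  move=> [q]; rewrite inE => /eqP -> ip.
  by rewrite (le_trans (origin_le_stage i) ip) si mem_strip_subcomplex_facet inE.
exists [:: origin] => p; rewrite /= /strip_at; split.
  by case: ifP => [op|]; [exists origin; rewrite ?mem_head|rewrite inE].
move=> [q]; rewrite inE => /eqP -> ->; rewrite inE sK /=.
by apply/forallP => i; rewrite (negbTE (si i)).
Qed.

Hypothesis d_ge2 : (1 < d)%N.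

Lemma stage_antichain i (i' : 'I_n) : (stage i <= stage i')%O -> i = i'.
Proof.
move=> /tuple_leP le; have := le (Ordinal (ltnW d_ge2)); have := le (Ordinal d_ge2).
rewrite !tnth_mktuple /= !ler_nat => h1 h0; apply: ord_inj.
by have := ltn_ord i; have := ltn_ord i'; lia.
Qed.

Lemma stage_nle_origin i : ~~ (stage i <= origin)%O.
Proof.
apply/negP => /tuple_leP/(_ (Ordinal (ltnW d_ge2))).
by rewrite !tnth_mktuple /= lern0.
Qed.

(** These sets have the origin as least element, hence are connected. *)
Definition avoiding_set T : set P :=
  [set p | (origin <= p)%O /\ forall i, i \in T -> ~~ (stage i <= p)%O].

Fact avoiding_set_Int T : avoiding_set T \in Int P.
Proof.
have o_in : avoiding_set T origin by split=> // i _; exact: stage_nle_origin.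
apply/mem_set; split.
- by exists origin.
- move=> p q r [op _] [_ qT] /andP[pr rq]; split; first exact: le_trans op pr.
  by move=> i /qT; apply: contraNN => /le_trans; exact.
- move=> p q pT qT; exists [:: origin; q]; split=> //.
    by move=> r; rewrite !inE => /orP[]/eqP ->.
  by rewrite /= /Order.comparable pT.1 qT.1 orbT.
Qed.

Definition avoiding T : Int P := exist _ (avoiding_set T) (avoiding_set_Int T).

Lemma avoiding_inj : injective avoiding.
Proof.
move=> T T' /(congr1 val) /= TT'.
have stageE (T0 : {set 'I_n}) i : avoiding_set T0 (stage i) <-> i \notin T0.
  split=> [[_ iT]|iT]; first by apply: contraT; rewrite negbK => /iT; rewrite lexx.
  split; first exact: origin_le_stage.
  by move=> k kT; apply: contraNN iT => /stage_antichain <-.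
apply/setP => i; apply/negb_inj; apply/idP/idP => /stageE.
  by rewrite TT' => /stageE.
by rewrite -TT' => /stageE.
Qed.

Definition stages_met (I : set P) : {set 'I_n} :=
  [set i : 'I_n | `[< exists2 p, I p & (stage i <= p)%O >]]%SET.

Lemma sub_avoiding (I : set P) T :
  I `<=` avoiding_set T <->
    I `<=` [set p | (origin <= p)%O] /\ T \subset ~: stages_met I.
Proof.
split=> [IT|[Io IT] p Ip]; [split=> [p /IT[]//|]|split; first exact: Io].
  apply/fintype.subsetP => i iT; rewrite !inE; apply/asboolP => -[p /IT[_ pT] ip].
  by move: (pT i iT); rewrite ip.
move=> i /(fintype.subsetP IT); rewrite !inE; apply: contraNN => ip.
by apply/asboolP; exists p.
Qed.

Lemma union_complex_strip (I : Int P) : val I `<=` [set p | (origin <= p)%O] ->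
  union_complex strip_filtration (val I) = strip_subcomplex m (stages_met (val I)).
Proof.
move=> Io; apply/setP => s; rewrite inE; apply/asboolP/idP => [[p Ip]|].
  rewrite /= /strip_at (Io p Ip); apply: fintype.subsetP.
  apply: strip_subcomplexS; apply/fintype.subsetP => i; rewrite !inE => ip.
  by apply/asboolP; exists p.
have [sK|sK] := boolP (s \in strip_complex n m); last first.
  by rewrite inE (negbTE sK).
have [/existsP[i /eqP ->]|/existsPn si _] :=
    boolP [exists i : 'I_n, s == strip_facet n m i].
  rewrite mem_strip_subcomplex_facet inE => /asboolP[p Ip ip].
  by exists p => //; rewrite /= /strip_at (Io p Ip) mem_strip_subcomplex_facet inE.
have [p Ip] := Int_nonempty I; exists p; first exact: set_mem.
rewrite /= /strip_at (Io p (set_mem Ip)) inE sK.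
by apply/forallP => i; rewrite (negbTE (si i)).
Qed.

(** The coefficient of [S is disjoint from T] in the rank: the three terms come
    from [S is everything], from n - #|S|, and from the constant. *)
Definition strip_weight T : int :=
  (-1) ^+ #|T| + (#|T| == 1%N)%:R + (T == finset.set0)%:R *
    ((\dim (cycles F m (strip_complex n m)))%:Z
      - (\dim (boundaries F m (strip_subcomplex m (finset.set0 : {set 'I_n}))))%:Z - n%:Z).

(** For I above the origin the rank is z - b0 - #|S| + [S is everything], where z
    and b0 are the dimensions of the cycles and of the initial boundaries; this
    is rewritten as a sum over the subsets T of the complement of S. *)
Lemma strip_rk (I : Int P) : (0 < n)%N ->
  (rk (homology_module F m strip_filtration) I)%:Z =
    \sum_(T | `[< val I `<=` val (avoiding T) >]) strip_weight T.
Proof.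
move=> n_gt0; have [Io|/existsNP[p /not_implyP[Ip np]]] :=
    pselect (val I `<=` [set p | (origin <= p)%O]); last first.
  rewrite (@homology_rk_eq0 _ _ _ _ _ _ _ _ Ip); last first.
    by rewrite /= /strip_at; case: ifP np.
  by rewrite big1 // => T /asboolP /(_ p Ip)[].
have cycE p : val I p ->
    cycles F m (strip_filtration p) = cycles F m (strip_complex n m).
  by move=> Ip; rewrite /= /strip_at (Io p Ip) cycles_strip.
rewrite (@homology_rk _ _ _ _ _ _ _ _ cycE) union_complex_strip //.
set S := stages_met _.
have BZ : (\dim (boundaries F m (strip_subcomplex m S)) <=
    \dim (cycles F m (strip_complex n m)))%N.
  rewrite -(cycles_strip F m S); apply/dimvS/boundary_sub_cycles.
  exact: strip_subcomplex_simplicial.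
have := dim_boundaries_strip F m S n_gt0.
rewrite (eq_bigl (fun T : {set 'I_n} => T \subset ~: S)); last first.
  by move=> T; apply/asboolP/idP => [/sub_avoiding[]|TS]; last exact/sub_avoiding.
rewrite /strip_weight !big_split /= sum_subset_sign.
have -> : \sum_(T : {set 'I_n} | T \subset ~: S) (#|T| == 1%N)%:R = #|(~: S)%SET|%:Z.
  rewrite (eq_bigr (fun T : {set 'I_n} => if #|T| == 1%N then 1 else 0)); last first.
    by move=> T _; case: eqP.
  rewrite -big_mkcondr sumr_const -(bin1 #|(~: S)%SET|) -cards_draws.
  by rewrite natz; congr Posz; apply: eq_card => T; rewrite [RHS]inE.
rewrite (bigD1 finset.set0) ?finset.sub0set //= eqxx mul1r big1 ?addr0; last first.
  by move=> T /andP[_ /negbTE ->]; rewrite mul0r.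
have -> : (~: S == finset.set0) = (S == [set: 'I_n]%SET).
  by rewrite -(inj_eq (@finset.setC_inj _)) finset.setCK finset.setC0.
have arith (z b b0 e k k' : nat) : (b <= z)%N -> (k + k' = n)%N ->
    (b + e = b0 + k)%N -> (z - b)%N%:Z = e%:Z + k'%:Z + (z%:Z - b0%:Z - n%:Z).
  lia.
rewrite natz => dimS; apply: arith BZ _ dimS.
by rewrite cardsC card_ord.
Qed.

Lemma strip_gpd_size : (0 < n)%N ->
  (2 ^ n - n.+1 <= gpd_size (homology_module F m strip_filtration))%N.
Proof.
move=> n_gt0; rewrite (gpd_size_comb avoiding_inj (fun I => strip_rk I n_gt0)).
apply: leq_trans (card_sets_ge2 n) _; apply: subset_leq_card.
apply/fintype.subsetP => T; rewrite !inE /strip_weight => T1.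
have -> : (#|T| == 1%N) = false by apply/negbTE; rewrite neq_ltn T1 orbT.
have -> : (T == finset.set0) = false.
  by apply/negbTE; rewrite -card_gt0; exact: ltn_trans T1.
by rewrite mul0r !addr0 signr_eq0.
Qed.

Lemma strip_num_simplices :
  (num_simplices strip_filtration <= (n + m).+2 ^ m.+2)%N.
Proof.
have := @card_small_sets _ m.+2 (strip_complex n m); rewrite card_ord; apply.
by move=> s /strip_complexP[-> ->].
Qed.

End StripFiltration.

Theorem theorem13 (F : fieldType) (R : realType) (d m : nat) :
  (2 <= d)%N ->
  ~ exists (k : nat) (C : R), 0 < C /\
      forall (V : finType) (X : filtration R d V), finite_filtration X ->
        (gpd_size (homology_module F m X))%:R <= C * (num_simplices X)%:R ^+ k.
Proof.
move=> d_ge2 [k [C [C_gt0 bound]]].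
pose c := Num.bound C.
have Cc : C <= c%:R by apply/ltW/archi_boundP/ltW.
have [n n_gt0 big] := exp_beats_poly c (m.+2 * k) m.
have := bound _ _ (@strip_filtration_finite R d n m).
apply/negP; rewrite -ltNge.
apply: (@le_lt_trans _ _ (c * (n + m).+2 ^ (m.+2 * k))%:R).
  rewrite natrM expnM natrX ler_pM ?exprn_ge0 ?ler0n ?(ltW C_gt0) //.
  by rewrite lerXn2r ?nnegrE ?ler0n // ler_nat; exact: strip_num_simplices.
rewrite ltr_nat; apply: leq_trans (strip_gpd_size F R m d_ge2 n_gt0).
by rewrite ltn_subRL addnC.
Qed.
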